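(* Let $\mathfrak M=\{M^\lambda:\lambda\in\Lambda\}$ be a weight matrix satisfying $(\mathfrak M_{\{dc\}})$ and $(\mathfrak M_{\{C^\omega\}})$. Then the following are equivalent: (1) $\mathcal E^{\{\mathfrak M\}}$ is stable under composition. (2) $\mathcal E^{\{\mathfrak M\}}$ is holomorphically closed. (3) For all $\lambda\in\Lambda$ there are $\mu\in\Lambda$ and $C>0$ such that $(M^\lambda_j)^{1/j}\le C(M^\mu_k)^{1/k}$ for all $1\le j\le k$. (4) $\mathfrak M$ satisfies $(\mathfrak M_{\{FdB\}})$. Moreover, $(\mathfrak M_{\{C^\omega\}})$ is only needed for (1)$\Rightarrow$(2), and $(\mathfrak M_{\{dc\}})$ is only needed for (3)$\Rightarrow$(4).
   Context: A weight matrix is a family $\mathfrak M=\{M^\lambda=(M^\lambda_k)_k\in\mathbb R_{>0}^{\mathbb N}:\lambda\in\Lambda\}$, $\Lambda$ an ordered subset of $\mathbb R$, such that each $(k!M^\lambda_k)_k$ is log-convex, $M^\lambda_0=1$, $(k!M^\lambda_k)^{1/k}\to\infty$, and $M^\lambda\le M^\mu$ termwise for $\lambda\le\mu$. For $M\in\mathbb R_{>0}^{\mathbb N}$, open $U\subseteq\mathbb R^n$, compact $K$, $\rho>0$: $\|f\|^M_{K,\rho}:=\sup\{\|f^{(k)}(x)\|/(k!\rho^kM_k):x\in K,k\in\mathbb N\}$; $\mathcal E^{\{M\}}(K,\mathbb R^m)$ = smooth maps on $K$ with $\|f\|^M_{K,\rho}<\infty$ for some $\rho$. $\mathcal E^{\{\mathfrak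 M\}}(U,\mathbb R^m):=\bigcap_{K\subseteq U\text{ compact}}\bigcup_\lambda\mathcal E^{\{M^\lambda\}}(K,\mathbb R^m)$ (functions on $U$ whose restriction to each compact $K$ lies in the union), $\mathcal E^{\{\mathfrak M\}}(U,V)$ those with values in open $V$. Conditions: $(\mathfrak M_{\{dc\}})$: $\forall\lambda\exists\mu\exists C\forall k: M^\lambda_{k+1}\le C^kM^\mu_k$. $(\mathfrak M_{\{C^\omega\}})$: $\exists\lambda:\liminf_k(M^\lambda_k)^{1/k}>0$. $(\mathfrak M_{\{FdB\}})$: $\forall\lambda\exists\mu:(M^\lambda)^\circ\preceq M^\mu$, where $M^\circ_k:=\max\{M_jM_{\alpha_1}\cdots M_{\alpha_j}:\alpha_i\in\mathbb N_{>0},\alpha_1+\dots+\alpha_j=k\}$, $M^\circ_0:=1$, and $M\preceq N$ means $\exists C,\rho>0\ \forall k: M_k\le C\rho^kN_k$. A class $\mathcal F$ is stable under composition if $g\in\mathcal F(U,V),f\in\mathcal F(V,W)\Rightarrow f\circ g\in\mathcal F(U,W)$ for all open $U\subseteq\mathbb R^p,V\subseteq\mathbb R^q,W\subseteq\mathbb R^r$; holomorphically closed if $f\circ g\in\mathcal F(U,\mathbb C)$ for each $g\in\mathcal F(U,\mathbb R)$ and each $f$ holomorphic near the range of $g$. *)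

(* Defs.v *)
From mathcomp Require Import all_boot all_order all_algebra.
From mathcomp Require Import all_classical all_reals all_analysis.
From mathcomp Require Import complex.
Import Order.TTheory GRing.Theory Num.Theory numFieldNormedType.Exports.

Set Implicit Arguments.
Unset Strict Implicit.
Unset Printing Implicit Defensive.

Local Open Scope classical_set_scope.
Local Open Scope ring_scope.

Section WeightMatrices.
Variable R : realType.

Definition weight_matrix (Lam : set R) (M : R -> nat -> R) : Prop :=
  [/\ (forall l, Lam l -> forall k, 0 < M l k),
      (forall l, Lam l -> M l 0%N = 1),
      (forall l, Lam l -> forall k,
         ((k.+1)`!%:R * M l k.+1) ^+ 2
           <= (k`!%:R * M l k) * ((k.+2)`!%:R * M l k.+2)),
      (forall l, Lam l ->
         (fun k : nat => (k`!%:R * M l k) `^ (k%:R^-1)) @ \oo --> +oo) &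
      (forall l mu, Lam l -> Lam mu -> l <= mu -> forall k, M l k <= M mu k)].

Definition WM_dc (Lam : set R) (M : R -> nat -> R) : Prop :=
  forall l, Lam l -> exists mu, Lam mu /\ exists C : R, 0 < C /\
    forall k : nat, M l k.+1 <= C ^+ k * M mu k.

Definition WM_Comega (Lam : set R) (M : R -> nat -> R) : Prop :=
  exists l, Lam l /\
    (0 < limn_einf (fun k : nat => ((M l k) `^ (k%:R^-1))%:E))%E.

Definition Mcirc (M : nat -> R) (k : nat) : R :=
  if k == 0%N then 1 else
  sup [set M (size s) * \prod_(a <- s) M a
      | s in [set s : seq nat | all (fun a => 0 < a)%N s /\ sumn s = k]].

Definition wpreceq (M N : nat -> R) : Prop :=
  exists C rho : R, [/\ 0 < C, 0 < rho & forall k, M k <= C * rho ^+ k * N k].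

Definition WM_FdB (Lam : set R) (M : R -> nat -> R) : Prop :=
  forall l, Lam l -> exists mu, Lam mu /\ wpreceq (Mcirc (M l)) (M mu).

Definition WM_root_cond (Lam : set R) (M : R -> nat -> R) : Prop :=
  forall l, Lam l -> exists mu, Lam mu /\ exists C : R, 0 < C /\
    forall j k : nat, (1 <= j)%N -> (j <= k)%N ->
      (M l j) `^ (j%:R^-1) <= C * (M mu k) `^ (k%:R^-1).

Definition enorm n (v : 'rV[R]_n) : R := Num.sqrt (\sum_(i < n) v ord0 i ^+ 2).

(** iterated directional derivative: iterD [:: v1; ...; vk] f x
    = f^{(k)}(x)(v1,...,vk) *)
Definition iterD n m (vs : seq 'rV[R]_n) (f : 'rV[R]_n -> 'rV[R]_m)
  : 'rV[R]_n -> 'rV[R]_m :=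
  foldr (fun v g => 'D_v g) f vs.

Definition smooth_on n m (U : set 'rV[R]_n) (f : 'rV[R]_n -> 'rV[R]_m) :=
  forall (vs : seq 'rV[R]_n) x, U x ->
    {for x, continuous (iterD vs f)} /\ forall v, derivable (iterD vs f) x v.

(** ||f||^M_{K,rho} < oo, where ||f^{(k)}(x)|| is the operator norm
    sup_{|v_i| <= 1} |f^{(k)}(x)(v_1,...,v_k)| *)
Definition bounded_MK n m (M : nat -> R) (K : set 'rV[R]_n) (rho : R)
    (f : 'rV[R]_n -> 'rV[R]_m) : Prop :=
  exists B : R, forall x (vs : seq 'rV[R]_n), K x ->
    all (fun v => enorm v <= 1) vs ->
    enorm (iterD vs f x) <= B * ((size vs)`!%:R * rho ^+ size vs * M (size vs)).

Definition in_EM n m (M : nat -> R) (K : set 'rV[R]_n) (f : 'rV[R]_n -> 'rV[R]_m) :=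
  exists rho : R, 0 < rho /\ bounded_MK M K rho f.

Definition in_EWM (Lam : set R) (M : R -> nat -> R) n m (U : set 'rV[R]_n)
    (f : 'rV[R]_n -> 'rV[R]_m) : Prop :=
  smooth_on U f /\
  forall K : set 'rV[R]_n, K `<=` U -> compact K ->
    exists l, Lam l /\ in_EM (M l) K f.

Definition in_EWM_into (Lam : set R) (M : R -> nat -> R) n m
    (U : set 'rV[R]_n) (V : set 'rV[R]_m) (f : 'rV[R]_n -> 'rV[R]_m) : Prop :=
  in_EWM Lam M U f /\ forall x, U x -> V (f x).

Definition stable_under_composition (Lam : set R) (M : R -> nat -> R) : Prop :=
  forall (p q r : nat) (U : set 'rV[R]_p) (V : set 'rV[R]_q) (W : set 'rV[R]_r),
    open U -> open V -> open W ->
    forall (g : 'rV[R]_p -> 'rV[R]_q) (f : 'rV[R]_q -> 'rV[R]_r),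
      in_EWM_into Lam M U V g -> in_EWM_into Lam M V W f ->
      in_EWM_into Lam M U W (f \o g).

Definition C_as_R2 (z : R[i]) : 'rV[R]_2 :=
  \row_(i < 2) (if i == ord0 then complex.Re z else complex.Im z).

Definition holomorphic_on (O : set R[i]) (f : R[i] -> R[i]) : Prop :=
  forall z, O z -> derivable (f : R[i]^o -> R[i]^o) z 1.

Definition holomorphically_closed (Lam : set R) (M : R -> nat -> R) : Prop :=
  forall (n : nat) (U : set 'rV[R]_n), open U ->
  forall (g : 'rV[R]_n -> 'rV[R]_1) (f : R[i] -> R[i]),
    in_EWM Lam M U g ->
    (exists O : set R[i], [/\ open (O : set R[i]^o),
        (forall x, U x -> O ((g x ord0 ord0)%:C)%C) & holomorphic_on O f]) ->
    in_EWM Lam M U (fun x => C_as_R2 (f ((g x ord0 ord0)%:C)%C)).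

End WeightMatrices.

(* Main.v *)
(** The cycle (1) => (2) => (3) => (4) => (1).

    (1) => (2).  A holomorphic function is real analytic on the real line, hence
    of class [E^{M}] by (C^omega), so (2) is a case of (1).  Only complex
    differentiability is given, so the Cauchy estimates are derived from scratch:
    Goursat's bisection argument in logarithmic polar coordinates shows that the
    circle means of [f (z + e^w) e^-w] do not depend on the radius, whence
    [|f' z| <= 4 sup |f| / r]; applied to difference quotients this estimate alone
    shows that [f'] is again holomorphic.

    (2) => (3).  With [m_k = k! M_k] and [nu_k = m_(k+1) / m_k], the function
    [g t = \sum_j 2^-j m_j nu_j^-j cos (nu_j t)] is of class [M] and its even
    derivatives at 0 alternate in sign and satisfy
    [|g^(2l) 0| >= 2^-2l m_2l].  Up to the same sign pattern the Taylor
    coefficients of [1 / (4 - g)] at 0 are sums of nonnegative terms, one of which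
    is the power [G_i^m] in order [2 i m]; membership of [1 / (4 - g)] in the class
    is then (3) for [j = 2i] and [k = 2im], and monotonicity of [m_k^(1/k)] gives
    the remaining [j] and [k].

    (3) => (4).  (dc) trades [M_(a_i)] for [M_(a_i - 1)], and
    [j + \sum_i (a_i - 1) = k].

    (4) => (1).  Faa di Bruno's formula, where the sum of
    [|pi|! a^|pi| \prod |B|!] over the set partitions [pi] of [k] elements is at
    most [k! (a + 2)^k]. *)
From HB Require Import structures.
From mathcomp Require Import all_boot all_order all_algebra.
From mathcomp Require Import all_classical all_reals all_analysis.
From mathcomp Require Import complex ring lra zify.
Require Import Defs.
Import Order.TTheory GRing.Theory Num.Theory numFieldNormedType.Exports.

Set Implicit Arguments.
Unset Strict Implicit.
Unset Printing Implicit Defensive.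

Local Open Scope classical_set_scope.
Local Open Scope ring_scope.

(** * Calculus of scalar smooth functions *)

Section RealCalculus.
Variable R : realType.

(** The definitions offer directional derivatives of vector-valued maps, while the chain rule needs
    total derivatives. Smoothness is therefore moved to scalar coordinates all of whose iterated
    derivatives are totally differentiable; this changes constants only.

    In (2) => (3) the test function must be real, so cosines replace exponentials. At 0 they see
    only even orders, which is why even indices come first and the others have to be interpolated.
    The 4 in 1 / (4 - g) exceeds sup |g| <= 2 m_0 = 2. The coefficients of g come from the
    supporting line of the convex sequence log m_k at j, whose slope is log nu_j: m_j nu_j^(k-j) <=
    m_k for all k, with equality at k = j.

    In (1) => (2) a circle mean bounds only the first derivative at the centre. The bounds n! rho^n
    for the higher derivatives come from n successive estimates, each spending an n-th part of the
    radius, and n^n <= 4^n n!. The same estimate, applied to differences of two difference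
    quotients, makes the difference quotients of f' a Cauchy family. *)

Lemma mean_value_ineq (u du : R -> R) (a b c e : R) :
  (forall s, `|s - a| <= `|b - a| -> is_derive s 1 u (du s)) ->
  (forall s, `|s - a| <= `|b - a| -> `|du s - c| <= e) ->
  `|u b - u a - c * (b - a)| <= e * `|b - a|.
Proof.
move=> Hd Hb.
have within_cont x y : (forall s, x <= s <= y -> `|s - a| <= `|b - a|) ->
    {within `[x, y], continuous u}.
  move=> H; apply: derivable_within_continuous => s; rewrite in_itv/= => hs.
  by have [] := Hd _ (H _ hs).
have [ab|ba] := leP a b.
  have H s : a <= s <= b -> `|s - a| <= `|b - a|.
    by move=> ?; rewrite !ger0_norm ?subr_ge0//; lra.
  have [|z] := @MVT_segment _ u du a b ab _ (within_cont _ _ H).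
    by move=> x; rewrite in_itv/= => hx; apply/Hd/H; lra.
  rewrite in_itv/= => hz ->.
  by rewrite -mulrBl normrM ler_wpM2r// Hb ?H.
have H s : b <= s <= a -> `|s - a| <= `|b - a|.
  by move=> ?; rewrite !ler0_norm ?subr_le0//; lra.
have [|z] := @MVT_segment _ u du b a (ltW ba) _ (within_cont _ _ H).
  by move=> x; rewrite in_itv/= => hx; apply/Hd/H; lra.
rewrite in_itv/= => hz E.
have -> : u b - u a - c * (b - a) = (du z - c) * (b - a).
  by rewrite mulrBl -(opprB (u a)) E; ring.
by rewrite normrM ler_wpM2r// Hb ?H.
Qed.

Lemma is_derive_line (V : normedModType R) (phi : V -> R) (y e : V) (t d : R) :
  is_derive (t *: e + y) e phi d ->
  is_derive t 1 (fun s => phi (s *: e + y)) d.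
Proof.
case=> + <-.
have E : (fun h : R => h^-1 *: (phi (h *: e + (t *: e + y)) - phi (t *: e + y)))
   = (fun h : R => h^-1 *:
     ((phi ((h *: (1 : R) + t) *: e + y) : R) - phi (t *: e + y))).
  by apply/funext => h; rewrite addrA -scalerDl [_ *: 1]mulr1.
rewrite /derivable /derive E => c; by split.
Qed.

(** Truncations are the corners of a staircase from x to x + k along the coordinate axes; each leg
    is a one-variable problem. *)
Definition row_trunc n (k : 'rV[R]_n) (j : nat) : 'rV[R]_n :=
  \row_i (if (i < j)%N then k ord0 i else 0).

Lemma row_norm_le n (v : 'rV[R]_n) e : 0 <= e ->
  (forall i, `|v ord0 i| <= e) -> `|v| <= e.
Proof.
move=> e0 H; rewrite /Num.Def.normr/= mx_normrE (bigmax_le _ e0)// => -[i j] _.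
by rewrite (ord1 i) H.
Qed.

Lemma row_coord_norm_le n (v : 'rV[R]_n) i : `|v ord0 i| <= `|v|.
Proof.
rewrite [leRHS]/Num.Def.normr/= mx_normrE.
exact: (le_bigmax _ (fun i : 'I_1 * 'I_n => `|v i.1 i.2|) (ord0, i)).
Qed.

Lemma row_truncS n (k : 'rV[R]_n) (j : 'I_n) :
  row_trunc k j.+1 = k ord0 j *: delta_mx ord0 j + row_trunc k j.
Proof.
apply/rowP => i; rewrite !mxE eqxx/= ltnS leq_eqVlt.
have [/val_inj ->|ne] := eqVneq (i : nat) j.
  by rewrite eqxx/= mulr1 ltnn addr0.
have -> : (i == j) = false by apply/negbTE; apply: contra ne => /eqP->.
by rewrite mulr0 add0r.
Qed.

(** Telescoping along the staircase: the norm is the maximum norm, so every leg stays within |k| of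
    x, and the mean value inequality charges e |k| for each of the n legs. *)
Lemma C1_increment n (phi : 'rV[R]_n -> R) (x k : 'rV[R]_n) (e : R) :
  (forall y i, `|y - x| <= `|k| ->
     derivable phi y (delta_mx ord0 i) /\
     `|'D_(delta_mx ord0 i) phi y - 'D_(delta_mx ord0 i) phi x| <= e) ->
  `|phi (k + x) - phi x - \sum_i k ord0 i * 'D_(delta_mx ord0 i) phi x|
    <= n%:R * e * `|k|.
Proof.
move=> H.
have main j : (j <= n)%N -> `|phi (row_trunc k j + x) - phi x
    - \sum_(i < n | (i < j)%N) k ord0 i * 'D_(delta_mx ord0 i) phi x|
    <= j%:R * e * `|k|.
  elim: j => [_|j IH jn].
    have -> : row_trunc k 0 = 0 by apply/rowP => i; rewrite !mxE.
    by rewrite add0r big1// !mul0r !subrr normr0.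
  pose jo := Ordinal jn.
  have -> : row_trunc k j.+1 = k ord0 jo *: delta_mx ord0 jo + row_trunc k j.
    exact: (row_truncS k jo).
  rewrite (bigD1 jo)/=; last exact: ltnSn.
  rewrite [\sum_(i < n | _ && _) _](eq_bigl (fun i : 'I_n => (i < j)%N)); last first.
    move=> i; rewrite ltnS leq_eqVlt -val_eqE/=.
    by case: ltngtP.
  have := IH (ltnW jn); set S := \sum_(_ < _ | _) _ => {}IH.
  set d := 'D_(delta_mx ord0 jo) phi x.
  pose y := row_trunc k j + x.
  have hy (s : R) : `|s - 0| <= `|k ord0 jo - 0| ->
      `|s *: delta_mx ord0 jo + y - x| <= `|k|.
    rewrite !subr0 => hs; rewrite addrA addrK; apply: row_norm_le => // i.
    rewrite !mxE eqxx/=.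
    have [->|ne] := eqVneq i jo.
      by rewrite ltnn addr0 mulr1 (le_trans hs)// row_coord_norm_le.
    rewrite mulr0 add0r; case: ifP => _; first exact: row_coord_norm_le.
    by rewrite normr0.
  have := @mean_value_ineq (fun s => phi (s *: delta_mx ord0 jo + y))
     (fun s => 'D_(delta_mx ord0 jo) phi (s *: delta_mx ord0 jo + y))
     0 (k ord0 jo) d e.
  have h1 (s : R) : `|s - 0| <= `|k ord0 jo - 0| -> is_derive s 1
      (fun s0 : R => phi (s0 *: delta_mx ord0 jo + y))
      ('D_(delta_mx ord0 jo) phi (s *: delta_mx ord0 jo + y)).
    move=> hs; apply: is_derive_line; apply: derivableP.
    by have [] := H _ jo (hy _ hs).
  have h2 (s : R) : `|s - 0| <= `|k ord0 jo - 0| ->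
     `|'D_(delta_mx ord0 jo) phi (s *: delta_mx ord0 jo + y) - d| <= e.
    by move=> hs; have [] := H _ jo (hy _ hs).
  move=> /(_ h1 h2); rewrite scale0r add0r subr0 -/y => st.
  have e0 : 0 <= e.
    have [|_] := H x jo; first by rewrite subrr normr0.
    by rewrite subrr normr0.
  rewrite -[k ord0 jo *: _ + _ + x]addrA -/y.
  have -> : phi (k ord0 jo *: delta_mx ord0 jo + y) - phi x -
     (k ord0 jo * d + S) =
     (phi (k ord0 jo *: delta_mx ord0 jo + y) - phi y - d * k ord0 jo) +
     (phi y - phi x - S) by ring.
  rewrite (le_trans (ler_normD _ _))// -natr1 mulrDl mul1r mulrDl addrC lerD//.
  by rewrite (le_trans st)// ler_wpM2l// row_coord_norm_le.
have := main n (leqnn n).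
have -> : row_trunc k n = k by apply/rowP => i; rewrite !mxE ltn_ord.
by rewrite [X in _ - X](eq_bigl predT)// => i; rewrite ltn_ord.
Qed.

Lemma differentiable_from_linear (V : normedModType R) (phi : V -> R)
    (x : V) (L : {linear V -> R}) : continuous L ->
  (forall e, 0 < e ->
    \forall k \near 0, `|phi (k + x) - phi x - L k| <= e * `|k|) ->
  differentiable phi x.
Proof.
move=> Lc H.
have key : phi \o shift x = cst (phi x) + L +o_ 0 id.
  apply/eqaddoP => e e0; near=> k.
  rewrite [X in `|X|](_ : _ = phi (k + x) - phi x - L k); last first.
    by rewrite -[LHS]/(phi (k + x) - (phi x + L k)) opprD addrA.
  by near: k; exact: H.
by apply/diff_locallyP; rewrite (diff_unique Lc key).
Unshelve. all: by end_near. Qed.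

Lemma C1_differentiable n (phi : 'rV[R]_n -> R) (x : 'rV[R]_n) :
  (\forall y \near x, forall i, derivable phi y (delta_mx ord0 i)) ->
  (forall i, {for x, continuous ('D_(delta_mx ord0 i) phi)}) ->
  differentiable phi x.
Proof.
move=> Hd Hc.
pose L (k : 'rV[R]_n) : R := \sum_i k ord0 i * 'D_(delta_mx ord0 i) phi x.
have Llin : linear L.
  move=> a u v; rewrite /L scaler_sumr -big_split/=; apply: eq_bigr => i _.
  by rewrite !mxE mulrDl -[_ *: _]/(_ * _) mulrA.
pose Lm := GRing.isLinear.Build _ _ _ _ _ Llin.
pose LL : {linear 'rV[R]_n -> R} := HB.pack L Lm.
have Lc : continuous L.
  move=> y; rewrite /L.
  apply: cvg_big => [||i _]; [exact: add_continuous|exact: nbhs_filter|].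
  apply: cvgMr_tmp; first exact: nbhs_filter.
  exact: (@coord_continuous R 1 n ord0 i y).
have {}Lc : continuous LL by [].
apply: (@differentiable_from_linear _ _ _ LL Lc) => e e0.
(* The n legs cost n e' in total; the successor keeps the divisor nonzero for n = 0. *)
pose e' := e / n.+1%:R.
have e'0 : 0 < e' by rewrite divr_gt0.
have Hc' : \forall y \near x, forall i,
    `|'D_(delta_mx ord0 i) phi x - 'D_(delta_mx ord0 i) phi y| <= e'.
  apply: (@filter_forall _ 'I_n (fun i y =>
     `|'D_(delta_mx ord0 i) phi x - 'D_(delta_mx ord0 i) phi y| <= e')
     (nbhs x) (nbhs_filter x)) => i.
  exact: ((cvgrPdist_le _ _).1 (Hc i)).
have /nbhs_ballP[r1 /= r10 H1] := Hd.
have /nbhs_ballP[r2 /= r20 H2] := Hc'.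
apply/nbhs_ballP; exists (Num.min r1 r2); first by rewrite /= lt_min r10.
move=> k; rewrite -ball_normE/= sub0r normrN lt_min => /andP[k1 k2].
have := @C1_increment _ phi x k e'; rewrite -[\sum_i _]/(LL k).
move=> /(_ _)/le_trans -> //.
  move=> y i hy; split.
    by apply: H1; rewrite -ball_normE/= distrC (le_lt_trans hy).
  by rewrite distrC; apply: H2; rewrite -ball_normE/= distrC (le_lt_trans hy).
rewrite ler_wpM2r// /e' mulrA ler_pdivrMr// mulrC ler_wpM2l// ?ltW//.
by rewrite ltr_nat.
Qed.

End RealCalculus.

(** * Smoothness and class bounds in coordinates *)

Section ScalarSmooth.
Variable R : realType.

Definition Ds n (vs : seq 'rV[R]_n) (phi : 'rV[R]_n -> R) : 'rV[R]_n -> R :=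
  foldr (fun v g => 'D_v g) phi vs.

(** Total differentiability of every iterated derivative is the form the chain rule consumes; on
    open sets it is equivalent to coordinatewise [smooth_on]. *)
Definition smoothS n (U : set 'rV[R]_n) (phi : 'rV[R]_n -> R) : Prop :=
  forall vs x, U x -> differentiable (Ds vs phi) x.

Lemma Ds_rcons n vs (v : 'rV[R]_n) phi : Ds (rcons vs v) phi = Ds vs ('D_v phi).
Proof. by rewrite /Ds foldr_rcons. Qed.

Lemma smoothS_D n (U : set 'rV[R]_n) phi v : smoothS U phi -> smoothS U ('D_v phi).
Proof. by move=> H vs x Ux; rewrite -Ds_rcons; exact: H. Qed.

Lemma open_near n (U : set 'rV[R]_n) (x : 'rV[R]_n) (P : 'rV[R]_n -> Prop) :
  open U -> U x -> (forall y, U y -> P y) -> \forall y \near x, P y.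
Proof.
move=> oU Ux H; apply: (@filterS _ (nbhs x) _ U) => //.
by apply: open_nbhs_nbhs.
Qed.

Lemma Ds_eq_on n (U : set 'rV[R]_n) phi psi : open U ->
  (forall x, U x -> phi x = psi x) ->
  forall vs x, U x -> Ds vs phi x = Ds vs psi x.
Proof.
move=> oU H; elim => [|v vs IH] x Ux /=; first exact: H.
by apply: near_eq_derive; exact: open_near Ux _.
Qed.

Lemma differentiable_littleo (V : normedModType R) (f : V -> R) (x : V) :
  differentiable f x -> forall e, 0 < e ->
  \forall k \near 0, `|f (k + x) - f x - 'd f x k| <= e * `|k|.
Proof.
move=> /diff_locally/eqaddoP H e e0; have := H e e0.
apply: filterS => k.
rewrite [X in `|X| <= _ -> _](_ : _ = f (k + x) - f x - 'd f x k)//.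
by rewrite -[LHS]/(f (k + x) - (f x + 'd f x k)) opprD addrA.
Qed.

Lemma differentiable_near_eq (V : normedModType R) (f g : V -> R) (x : V) :
  (\forall y \near x, f y = g y) -> differentiable f x -> differentiable g x.
Proof.
move=> fg df; have fgx := nbhs_singleton fg.
apply: (@differentiable_from_linear R V g x ('d f x)).
  exact: diff_continuous.
move=> e e0; have H := differentiable_littleo df e0.
have fg' : \forall k \near 0, f (k + x) = g (k + x).
  move/nbhs_ballP: fg => [r /= r0 Hr]; apply/nbhs_ballP; exists r => //= k.
  rewrite -ball_normE/= sub0r normrN => kr; apply: Hr.
  by rewrite -ball_normE/= opprD addrCA subrr addr0 normrN.
near=> k; rewrite -fgx.
have <- : f (k + x) = g (k + x) by near: k.
by near: k.
Unshelve. all: by end_near. Qed.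

Lemma iterD_coord n m (U : set 'rV[R]_n) (f : 'rV[R]_n -> 'rV[R]_m) :
  open U -> smooth_on U f -> forall vs x c, U x ->
  iterD vs f x ord0 c = Ds vs (fun y => f y ord0 c) x.
Proof.
move=> oU sf; elim => [//|v vs IH] x c Ux /=.
have [_ dv] := sf vs x Ux.
rewrite -/(iterD vs f) (derive_mx (dv v)) mxE; apply: near_eq_derive.
by apply: open_near Ux _ => // y Uy; exact: IH.
Qed.

Lemma continuous_near_eq (V W : topologicalType) (f g : V -> W) (x : V) :
  (\forall y \near x, f y = g y) -> {for x, continuous f} ->
  {for x, continuous g}.
Proof.
move=> fg; rewrite /prop_for /continuous_at -(nbhs_singleton fg).
by apply: cvg_trans; apply: near_eq_cvg.
Qed.

(** The partial derivatives of an iterated derivative are again iterated derivatives, hence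
    continuous, so [C1_differentiable] applies. *)
Lemma smooth_on_smoothS n m (U : set 'rV[R]_n) (f : 'rV[R]_n -> 'rV[R]_m) :
  open U -> smooth_on U f -> forall c, smoothS U (fun y => f y ord0 c).
Proof.
move=> oU sf c vs x Ux; apply: C1_differentiable.
  apply: open_near Ux _ => // y Uy i.
  have [_ /(_ (delta_mx ord0 i))/derivable_mxP/(_ ord0 c)] := sf vs y Uy.
  apply: near_eq_derivable; apply: open_near Uy _ => // z Uz.
  by rewrite (iterD_coord oU sf).
move=> i; set e := delta_mx ord0 i.
have [cf _] := sf (e :: vs) x Ux.
have E y : U y -> iterD (e :: vs) f y ord0 c
    = 'D_e (Ds vs (fun y => f y ord0 c)) y.
  by move=> Uy; rewrite (iterD_coord oU sf).
have cc : (fun y => iterD (e :: vs) f y ord0 c) @ x -->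
    iterD (e :: vs) f x ord0 c.
  exact: (cvg_comp _ _ cf (@coord_continuous R 1 m ord0 c _)).
by apply: continuous_near_eq cc; apply: open_near Ux _ => // y Uy; rewrite E.
Qed.

Lemma cvg_rowP (T : Type) (F : set_system T) (FF : Filter F) n
    (f : T -> 'rV[R]_n) (l : 'rV[R]_n) :
  (forall i, (fun t => f t ord0 i) @ F --> l ord0 i) -> f @ F --> l.
Proof.
move=> H; apply/cvgrPdist_le => e e0.
have H' : \forall t \near F, forall i, `|l ord0 i - f t ord0 i| <= e.
  apply: (@filter_forall _ 'I_n (fun i t => `|l ord0 i - f t ord0 i| <= e)).
  by move=> i; exact: ((cvgrPdist_le _ _).1 (H i)).
apply: filterS H' => t Ht; apply: row_norm_le; first exact: ltW.
by move=> i; rewrite !mxE.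
Qed.

(** A vector-valued derivative splits into coordinates only once derivability is known. Hence [der]
    assumes the coordinate formula for [vs], and the induction in [coord] calls it to pass to
    [v :: vs]. *)
Lemma smoothS_iterD n m (U : set 'rV[R]_n) (f : 'rV[R]_n -> 'rV[R]_m) :
  open U -> (forall c, smoothS U (fun y => f y ord0 c)) ->
  forall vs x, U x ->
  [/\ forall c, iterD vs f x ord0 c = Ds vs (fun y => f y ord0 c) x,
     {for x, continuous (iterD vs f)} & forall v, derivable (iterD vs f) x v].
Proof.
move=> oU sf.
have der vs : (forall x c, U x ->
      iterD vs f x ord0 c = Ds vs (fun y => f y ord0 c) x) ->
    forall x v, U x -> derivable (iterD vs f) x v.
  move=> E x v Ux; apply/derivable_mxP => i j; rewrite (ord1 i).
  have /diff_derivable dv := sf j vs x Ux.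
  apply: near_eq_derivable (dv v); apply: open_near Ux _ => // y Uy.
  by rewrite E.
have coord vs : forall x c, U x ->
      iterD vs f x ord0 c = Ds vs (fun y => f y ord0 c) x.
  elim: vs => [//|v vs IH] x c Ux /=.
  rewrite -/(iterD vs f) (derive_mx (der _ IH _ _ Ux)) mxE.
  by apply: near_eq_derive; apply: open_near Ux _ => // y Uy; exact: IH.
move=> vs x Ux; split; [by move=> c; exact: coord| |by move=> v; exact: (der _ (coord vs))].
apply: (@cvg_rowP _ (nbhs x) (nbhs_filter x)) => i.
have /differentiable_continuous := sf i vs x Ux.
by apply: continuous_near_eq; apply: open_near Ux _ => // y Uy; rewrite coord.
Qed.

Lemma enorm_coord n (v : 'rV[R]_n) i : `|v ord0 i| <= enorm v.
Proof.
rewrite -sqrtr_sqr ler_wsqrtr// (bigD1 i)//= lerDl sumr_ge0// => j _.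
exact: sqr_ge0.
Qed.

Lemma enorm_le n (v : 'rV[R]_n) b : 0 <= b ->
  (forall i, `|v ord0 i| <= b) -> enorm v <= n%:R * b.
Proof.
move=> b0 H; have nb0 : 0 <= n%:R * b by rewrite mulr_ge0.
rewrite -[leRHS]ger0_norm// -sqrtr_sqr ler_wsqrtr//.
apply: (@le_trans _ _ (\sum_(i < n) b ^+ 2)).
  by apply: ler_sum => i _; rewrite -[leLHS]real_normK ?num_real// lerXn2r ?nnegrE.
rewrite sumr_const card_ord -[b ^+ 2 *+ _]mulr_natl exprMn ler_wpM2r ?sqr_ge0//.
case: n {H nb0 v} => [|n]; first by rewrite expr0n.
by rewrite -natrX ler_nat leq_pmull.
Qed.

Lemma enorm_delta n (i : 'I_n) : enorm (delta_mx ord0 i : 'rV[R]_n) = 1.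
Proof.
rewrite /enorm (bigD1 i)//= big1 => [|j ne]; rewrite mxE eqxx/= ?eqxx/=.
  by rewrite expr1n addr0 sqrtr1.
by rewrite (negbTE ne) expr0n.
Qed.

Definition coord_bound n m (M : nat -> R) (K : set 'rV[R]_n)
    (f : 'rV[R]_n -> 'rV[R]_m) : Prop :=
  exists rho B : R, [/\ 0 < rho, 0 <= B &
    forall x vs c, K x -> all (fun v => enorm v <= 1) vs ->
    `|Ds vs (fun y => f y ord0 c) x|
      <= B * ((size vs)`!%:R * rho ^+ size vs * M (size vs))].

(** Replacing the Euclidean norm by coordinates costs at most a factor m, which the constant B
    absorbs. *)
Lemma in_EWM_coordP (Lam : set R) (M : R -> nat -> R) n m (U : set 'rV[R]_n)
    (f : 'rV[R]_n -> 'rV[R]_m) :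
  (forall l, Lam l -> forall k, 0 < M l k) -> open U ->
  in_EWM Lam M U f <->
  (forall c, smoothS U (fun y => f y ord0 c)) /\
  (forall K : set 'rV[R]_n, K `<=` U -> compact K ->
    exists l, Lam l /\ coord_bound (M l) K f).
Proof.
move=> Mpos oU; split=> [[sf H]|[sf H]].
  split; first exact: smooth_on_smoothS.
  move=> K KU cK; have [l [Ll [rho [rho0 [B HB]]]]] := H K KU cK.
  (* The sign of B is unknown when K is empty, hence the absolute value. *)
  exists l; split => //; exists rho, `|B|; split => // x vs c Kx evs.
  rewrite -(iterD_coord oU sf); last exact: KU.
  rewrite (le_trans (enorm_coord _ _))// (le_trans (HB x vs Kx evs))//.
  by rewrite ler_wpM2r ?ler_norm// ?mulr_ge0 ?exprn_ge0 ?ltW// Mpos.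
split.
  by move=> vs x Ux; have [_ ? ?] := smoothS_iterD oU sf vs Ux.
move=> K KU cK; have [l [Ll [rho [B [rho0 B0 HB]]]]] := H K KU cK.
exists l; split => //; exists rho; split => //; exists (m%:R * B).
move=> x vs Kx evs; rewrite -(mulrA m%:R); apply: enorm_le.
  rewrite mulr_ge0// mulr_ge0 ?(ltW (Mpos _ Ll _))// mulr_ge0//.
  by rewrite exprn_ge0// ltW.
by move=> c; have [-> _ _] := smoothS_iterD oU sf vs (KU _ Kx); exact: HB.
Qed.

End ScalarSmooth.

(** * Composition *)

Section ChainRule.
Variable R : realType.

Lemma differentiable_row (V : normedModType R) n (g : V -> 'rV[R]_n) (x : V) :
  (forall i, differentiable (fun y => g y ord0 i) x) -> differentiable g x.
Proof.
move=> H.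
have -> : g = \sum_(i < n) (fun y => g y ord0 i *: (delta_mx ord0 i : 'rV[R]_n)).
  by apply/funext => y; rewrite fct_sumE; exact: row_sum_delta.
by apply: differentiable_sum => i; exact: differentiableZl.
Qed.

Lemma chain_rule (V : normedModType R) n (g : V -> 'rV[R]_n)
    (phi : 'rV[R]_n -> R) (x : V) :
  (forall i, differentiable (fun y => g y ord0 i) x) ->
  differentiable phi (g x) ->
  differentiable (phi \o g) x /\ forall v, 'D_v (phi \o g) x =
   \sum_(i < n) 'D_v (fun y => g y ord0 i) x * 'D_(delta_mx ord0 i) phi (g x).
Proof.
move=> dg dphi; have dg' := differentiable_row dg.
have dc := differentiable_comp dg' dphi; split => // v.
rewrite (deriveE _ dc) diff_comp//= -(deriveE _ dg').
rewrite [X in 'd phi (g x) X](row_sum_delta ('D_v g x)) linear_sum.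
apply: eq_bigr => i _; rewrite linearZ/= (deriveE _ dphi); congr (_ * _).
by rewrite derive_mx ?mxE//; exact: diff_derivable.
Qed.

Lemma derive_seq_sum (V : normedModType R) (I : Type) (s : seq I)
    (F : I -> V -> R) (x : V) : (forall a, differentiable (F a) x) ->
  differentiable (fun y => \sum_(a <- s) F a y) x /\
  forall v, 'D_v (fun y => \sum_(a <- s) F a y) x = \sum_(a <- s) 'D_v (F a) x.
Proof.
move=> dF; elim: s => [|a s [IHd IH]].
  have -> : (fun y => \sum_(a <- [::]) F a y) = cst 0.
    by apply/funext => y; rewrite big_nil.
  by split=> [|v]; [exact: differentiable_cst|rewrite big_nil derive_cst].
have -> : (fun y => \sum_(a <- a :: s) F a y)
    = F a + (fun y => \sum_(a <- s) F a y).
  by apply/funext => y; rewrite big_cons.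
split=> [|v]; first exact: differentiableD.
by rewrite deriveD ?IH ?big_cons//; exact: diff_derivable.
Qed.

End ChainRule.

(** * Faa di Bruno's formula over set partitions *)

Section FaaDiBruno.
Variable R : realType.
Variables (p q : nat) (U : set 'rV[R]_p) (V : set 'rV[R]_q).
Variable g : 'rV[R]_p -> 'rV[R]_q.
Hypotheses (oU : open U) (oV : open V).
Hypothesis gsm : forall i, smoothS U (fun y => g y ord0 i).
Hypothesis gUV : forall x, U x -> V (g x).

(* Expansion in coordinates of [f^(j)(g x)(g^(B_1) x, ..., g^(B_j) x)] *)
Fixpoint FdB_term (Bs : seq (seq 'rV[R]_p)) (phi : 'rV[R]_q -> R)
    (x : 'rV[R]_p) : R :=
  if Bs is B :: Bs' then
    \sum_(i < q) Ds B (fun y => g y ord0 i) x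
      * FdB_term Bs' ('D_(delta_mx ord0 i) phi) x
  else phi (g x).

(* All ways of adding [v] to an ordered set partition, either to one of the
   blocks or as a new last block *)
Fixpoint FdB_extend (T : Type) (v : T) (Bs : seq (seq T)) : seq (seq (seq T)) :=
  if Bs is B :: Bs' then
    ((v :: B) :: Bs') :: map (cons B) (FdB_extend v Bs')
  else [:: [:: [:: v]]].

(** Inserting the entries from the last to the first yields each set partition of the positions in
    [vs] exactly once. *)
Fixpoint set_partitions (T : Type) (vs : seq T) : seq (seq (seq T)) :=
  if vs is v :: vs' then flatten (map (FdB_extend v) (set_partitions vs'))
  else [:: [::]].

(** By the product rule the new direction either hits a derivative of g and joins its block, or hits
    the outer derivative of phi, where the chain rule opens the block [v]. The induction ranges over
    all phi because each block puts one more partial derivative on it. *)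
Lemma FdB_term_derive Bs phi x : smoothS V phi -> U x ->
  differentiable (FdB_term Bs phi) x /\ forall v,
  'D_v (FdB_term Bs phi) x = \sum_(Bs' <- FdB_extend v Bs) FdB_term Bs' phi x.
Proof.
move=> + Ux; elim: Bs phi => [|B Bs IH] phi sphi.
  have [||d D] := @chain_rule R _ _ g phi x.
  - by move=> i; exact: (gsm i [::] Ux).
  - by apply: (sphi [::]); exact: gUV.
  split => // v; rewrite -[FdB_term [::] phi]/(phi \o g) D big_seq1 /=.
  by apply: eq_bigr.
have IHi i := IH _ (smoothS_D (delta_mx ord0 i) sphi).
pose F i := Ds B (fun y => g y ord0 i).
pose G i := FdB_term Bs ('D_(delta_mx ord0 i) phi).
have dF i : differentiable (F i) x by exact: gsm.
have dG i : differentiable (G i) x by have [] := IHi i.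
have -> : FdB_term (B :: Bs) phi = fun y => \sum_(i <- index_enum 'I_q) (F i * G i) y.
  by apply/funext => y.
have [d D] := @derive_seq_sum R _ _ (index_enum 'I_q) (fun i => F i * G i) x
  (fun i => differentiableM (dF i) (dG i)).
split => // v; rewrite D /= big_cons big_map.
rewrite (eq_bigr (fun i => 'D_v (F i) x * G i x + F i x * 'D_v (G i) x)); last first.
  move=> i _; rewrite deriveM; [|exact: diff_derivable|exact: diff_derivable].
  by rewrite addrC; congr (_ + _); rewrite -[_ *: _]/(_ * _) mulrC.
rewrite big_split/=; congr (_ + _).
rewrite exchange_big/=; apply: eq_bigr => i _.
by have [_ ->] := IHi i; rewrite big_distrr.
Qed.

Lemma Ds_comp phi vs x : smoothS V phi -> U x ->
  differentiable (Ds vs (phi \o g)) x /\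
  Ds vs (phi \o g) x = \sum_(Bs <- set_partitions vs) FdB_term Bs phi x.
Proof.
move=> sphi; elim: vs x => [|v vs IH] x Ux.
  by split; [have [] := @FdB_term_derive [::] phi x sphi Ux|rewrite /= big_seq1].
have E y : U y -> 'D_v (Ds vs (phi \o g)) y =
    \sum_(Bs <- set_partitions (v :: vs)) FdB_term Bs phi y.
  move=> Uy.
  rewrite (@near_eq_derive _ _ _ _
    (fun z => \sum_(Bs <- set_partitions vs) FdB_term Bs phi z)); last first.
    by apply: open_near Uy _ => // z Uz; have [] := IH z Uz.
  have [_ ->] := @derive_seq_sum R _ _ (set_partitions vs)
    (fun Bs => FdB_term Bs phi) y
    (fun Bs => (@FdB_term_derive Bs phi y sphi Uy).1).
  rewrite /= big_flatten/= big_map; apply: eq_bigr => Bs _.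
  by have [_ ->] := @FdB_term_derive Bs phi y sphi Uy.
split; last exact: E.
apply: (@differentiable_near_eq _ _
  (fun z => \sum_(Bs <- set_partitions (v :: vs)) FdB_term Bs phi z)).
  by apply: open_near Ux _ => // z Uz; rewrite -E.
have [//] := @derive_seq_sum R _ _ (set_partitions (v :: vs))
    (fun Bs => FdB_term Bs phi) x
    (fun Bs => (@FdB_term_derive Bs phi x sphi Ux).1).
Qed.

Lemma smoothS_comp phi : smoothS V phi -> smoothS U (phi \o g).
Proof. by move=> sphi vs x Ux; have [] := Ds_comp vs sphi Ux. Qed.

(** The list [es] collects the basis directions already applied to phi, so that the induction ends
    at order [size es + size Bs]. Each block sums over q coordinates, hence the factor q. *)
Lemma FdB_term_bound (N G : nat -> R) phi x :
  (forall j, 0 <= N j) -> (forall j, 0 <= G j) ->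
  (forall es, all (fun v => enorm v <= 1) es ->
    `|Ds es phi (g x)| <= N (size es)) ->
  (forall B i, all (fun v => enorm v <= 1) B ->
    `|Ds B (fun y => g y ord0 i) x| <= G (size B)) ->
  forall Bs es, all (all (fun v => enorm v <= 1)) Bs ->
  all (fun v => enorm v <= 1) es ->
  `|FdB_term Bs (Ds es phi) x|
    <= N (size es + size Bs)%N * \prod_(B <- Bs) (q%:R * G (size B)).
Proof.
move=> N0 G0 HN HG; elim => [|B Bs IH] es /=.
  by move=> _ hes; rewrite big_nil mulr1 addn0 HN.
move=> /andP[hB hBs] hes; rewrite big_cons.
apply: le_trans (ler_norm_sum _ _ _) _.
apply: (@le_trans _ _ (\sum_(i < q) G (size B)
   * (N (size es + (size Bs).+1)%N * \prod_(B <- Bs) (q%:R * G (size B))))).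
  apply: ler_sum => i _; rewrite normrM ler_pM// ?HG//.
  have := IH (delta_mx ord0 i :: es) hBs; rewrite /= enorm_delta lexx hes.
  by rewrite addSn addnS => /(_ isT).
rewrite sumr_const card_ord -[_ *+ q]mulr_natl le_eqVlt; apply/predU1P; left.
by ring.
Qed.

End FaaDiBruno.

Section PartitionSum.
Variables (R : realType) (T : Type).
Implicit Types (v : T) (vs : seq T) (Bs : seq (seq T)).

(** Joining a block B multiplies |B|! by |B| + 1, and these factors add up to the number of elements
    plus the number of blocks; a new block contributes 1!. The weight h is arbitrary because peeling
    off a block shifts its argument. *)
Lemma FdB_extend_sum (h : nat -> R) v Bs :
  \sum_(Bs' <- FdB_extend v Bs)
     h (size Bs') * \prod_(B <- Bs') (size B)`!%:R =
  (h (size Bs) * (sumn (map size Bs) + size Bs)%:R + h (size Bs).+1)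
    * \prod_(B <- Bs) (size B)`!%:R.
Proof.
elim: Bs h => [|B Bs IH] h /=.
  by rewrite !big_seq1 big_nil (_ : 1`! = 1%N)// !mulr1 mulr0 add0r.
rewrite big_cons big_map [\prod_(B0 <- B :: Bs) _]big_cons.
rewrite [\prod_(B0 <- (v :: B) :: Bs) _]big_cons.
rewrite (eq_bigr (fun Bs' => (size B)`!%:R *
   (h (size Bs').+1 * \prod_(B0 <- Bs') (size B0)`!%:R))); last first.
  by move=> Bs' _; rewrite big_cons mulrCA.
rewrite -big_distrr/= (IH (fun n => h n.+1)) factS natrM.
rewrite !natrD -!natr1; ring.
Qed.


End PartitionSum.

(** * From the root condition to the Faa di Bruno condition *)

Section RootCondition.
Variable R : realType.
Implicit Types (Lam : set R) (M : R -> nat -> R).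

Lemma powR_invn_exprn (x : R) n : 0 <= x -> (0 < n)%N ->
  (x `^ n%:R^-1) ^+ n = x.
Proof.
move=> x0 n0; rewrite -powR_mulrn ?powR_ge0// -powRrM mulVf ?powRr1//.
by rewrite pnatr_eq0 -lt0n.
Qed.

(** The maximum in M° is encoded as a real [sup], which dominates its members only for a bounded
    set. X >= 1 dominates N_0, ..., N_k, and a product has at most k + 1 factors. *)
Lemma Mcirc_has_sup (N : nat -> R) k : (forall i, 0 < N i) ->
  has_ubound [set N (size s) * \prod_(a <- s) N a
      | s in [set s : seq nat | all (fun a => 0 < a)%N s /\ sumn s = k]].
Proof.
move=> N0; pose X : R := 1 + \sum_(i < k.+1) N i.
have X1 : 1 <= X by rewrite lerDl sumr_ge0// => i _; exact: ltW.
have NX i : (i <= k)%N -> N i <= X.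
  move=> ik; rewrite /X (bigD1 (Ordinal (n:=k.+1) (m:=i) ik))//= addrCA lerDl.
  by rewrite addr_ge0// sumr_ge0// => j _; exact: ltW.
exists (X ^+ k.+1) => _ [s [s0 sk] <-].
have H t : all (fun a => 0 < a)%N t -> (sumn t <= k)%N ->
    \prod_(a <- t) N a <= X ^+ size t /\ (size t <= sumn t)%N.
  elim: t => [|a t IH]; first by rewrite big_nil.
  rewrite /= big_cons => /andP[a0 t0] sk'.
  have [||h1 h2] := IH => //; first by rewrite (leq_trans _ sk')// leq_addl.
  split; last by rewrite -add1n leq_add.
  rewrite exprS ler_pM//; first exact: ltW.
    by rewrite prodr_ge0// => i _; exact: ltW.
  by rewrite NX// (leq_trans _ sk')// leq_addr.
have [|h1 h2] := H s s0; first by rewrite sk.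
rewrite sk in h2.
rewrite exprS ler_pM ?NX//; first exact: ltW.
  by rewrite prodr_ge0// => i _; exact: ltW.
by rewrite (le_trans h1)// ler_weXn2l.
Qed.

Lemma le_Mcirc (N : nat -> R) s : (forall i, 0 < N i) -> N 0%N = 1 ->
  all (fun a => 0 < a)%N s ->
  N (size s) * \prod_(a <- s) N a <= Mcirc N (sumn s).
Proof.
move=> N0 N1 s0; rewrite /Mcirc; case: eqP => [|_].
  case: s s0 => [|a s] /=; first by rewrite big_nil N1 mulr1.
  by move=> /andP[a0 _] /eqP; rewrite addn_eq0 -leqn0 leqNgt a0.
by apply: ub_le_sup; [exact: Mcirc_has_sup | exists s].
Qed.

Lemma root_cond_FdB Lam M : weight_matrix Lam M -> WM_dc Lam M ->
  WM_root_cond Lam M -> WM_FdB Lam M.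
Proof.
move=> [Mpos M0 _ _ Mmon] dc rc l Ll.
have [mu0 [Lmu0 [C [C0 HC]]]] := dc l Ll.
(* One weight has to dominate both M^l, for the outer factor, and M^mu0, for the shifted inner
   factors. *)
pose mu := Num.max l mu0.
have Lmu : Lam mu by rewrite /mu; case: leP.
have lmu k : M l k <= M mu k by rewrite Mmon// le_max lexx.
have mu0mu k : M mu0 k <= M mu k by rewrite Mmon// le_max lexx orbT.
have [nu [Lnu [D [D0 HD]]]] := rc mu Lmu.
exists nu; split => //.
pose C1 := Num.max 1 C.
have C11 : 1 <= C1 by rewrite le_max lexx.
have C1C : C <= C1 by rewrite le_max lexx orbT.
have C10 : 0 < C1 by exact: lt_le_trans C11.
exists 1, (C1 * D); split => //; first exact: mulr_gt0.
move=> [|k]; first by rewrite /Mcirc eqxx M0// expr0 !mulr1.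
rewrite mul1r /Mcirc; apply: ge_sup.
  by exists (M l 1 * \prod_(a <- [:: k.+1]) M l a), [:: k.+1] => //=; rewrite addn0.
move=> _ [s [s0 sk] <-].
(* In terms of Z the root condition reads M^mu_a <= Z^a for every a <= k + 1, so the products reduce
   to counting exponents. *)
pose Z := D * (M nu k.+1) `^ (k.+1%:R^-1).
have Z0 : 0 <= Z by rewrite mulr_ge0 ?powR_ge0// ltW.
have MZ a : (a <= k.+1)%N -> M mu a <= Z ^+ a.
  case: a => [|a] ak; first by rewrite M0.
  rewrite -[leLHS](@powR_invn_exprn _ a.+1) ?(ltW (Mpos _ _ _))//.
  by rewrite lerXn2r ?nnegrE ?powR_ge0// HD.
(* [Z ^+ size t] stands for the outer factor and lends one Z to each inner factor, which by (dc)
   supplies only a - 1 of them. *)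
have main t : all (fun a => 0 < a)%N t -> (sumn t <= k.+1)%N ->
    Z ^+ size t * \prod_(a <- t) M l a <= C1 ^+ sumn t * Z ^+ sumn t
    /\ (size t <= sumn t)%N.
  elim: t => [|a t IH]; first by rewrite big_nil !expr0 mulr1.
  rewrite /= big_cons => /andP[a0 t0] sk'.
  have [||h1 h2] := IH => //; first by rewrite (leq_trans _ sk')// leq_addl.
  split; last by rewrite -add1n leq_add.
  rewrite exprS mulrACA !exprD [leRHS]mulrACA ler_pM//.
  - by rewrite mulr_ge0// ltW// Mpos.
  - by rewrite mulr_ge0 ?exprn_ge0// prodr_ge0// => i _; rewrite ltW// Mpos.
  case: a a0 sk' => // a _ sk'; rewrite [Z ^+ a.+1]exprS mulrCA ler_wpM2l//.
  apply: (le_trans (HC a)); apply: ler_pM.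
  - by rewrite exprn_ge0// ltW.
  - by rewrite ltW// Mpos.
  - apply: (@le_trans _ _ (C1 ^+ a)); last by rewrite ler_weXn2l.
    by rewrite lerXn2r ?nnegrE// ltW.
  rewrite (le_trans (mu0mu a))// MZ//.
  by rewrite (leq_trans _ sk')// addSn ltnW// ltnS leq_addr.
have [|h1 h2] := main s s0; first by rewrite sk.
rewrite sk in h1 h2.
have -> : (C1 * D) ^+ k.+1 * M nu k.+1 = C1 ^+ k.+1 * Z ^+ k.+1.
  by rewrite /Z !exprMn powR_invn_exprn ?ltW ?Mpos// mulrA.
apply: le_trans h1; rewrite ler_wpM2r//.
  by rewrite prodr_ge0// => i _; rewrite ltW// Mpos.
by rewrite (le_trans (lmu _))// MZ.
Qed.

End RootCondition.

Section PartitionInvariants.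
Variable R : realType.

Lemma FdB_extend_inv (T : eqType) (P : pred T) v (Bs Bs' : seq (seq T)) :
  P v -> all (all P) Bs -> all (fun a => 0 < a)%N (map size Bs) ->
  Bs' \in FdB_extend v Bs ->
  [/\ all (all P) Bs', all (fun a => 0 < a)%N (map size Bs') &
      sumn (map size Bs') = (sumn (map size Bs)).+1].
Proof.
move=> Pv; elim: Bs Bs' => [|B Bs IH] Bs' /=.
  by rewrite mem_seq1 => _ _ /eqP ->; rewrite /= Pv.
move=> /andP[hB hBs] /andP[pB pBs]; rewrite in_cons => /predU1P[->|].
  by rewrite /= Pv hB hBs pBs addSn.
case/mapP => Bs1 /(IH _ hBs pBs)[h1 h2 h3] ->.
by rewrite /= hB h1 pB h2 h3 addnS.
Qed.

Lemma set_partitions_inv (T : eqType) (P : pred T) vs (Bs : seq (seq T)) :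
  all P vs -> Bs \in set_partitions vs ->
  [/\ all (all P) Bs, all (fun a => 0 < a)%N (map size Bs) &
      sumn (map size Bs) = size vs].
Proof.
elim: vs Bs => [|v vs IH] Bs /=; first by rewrite mem_seq1 => _ /eqP ->.
move=> /andP[Pv Pvs] /flatten_mapP[Bs1 /(IH _ Pvs)[h1 h2 h3]].
by move=> /(FdB_extend_inv Pv h1 h2); rewrite h3.
Qed.

Lemma size_le_sumn s : all (fun a => 0 < a)%N s -> (size s <= sumn s)%N.
Proof.
by elim: s => [//|a s IH] /= /andP[a0 /IH h]; rewrite -add1n leq_add.
Qed.

(** Inserting one more element into a partition of k elements with j <= k blocks multiplies its
    weight, in total, by (k + j) + (j + 1) a <= (k + 1)(a + 2). *)
Lemma set_partitions_sum (T : eqType) (a : R) (vs : seq T) : 0 <= a ->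
  \sum_(Bs <- set_partitions vs)
     (size Bs)`!%:R * a ^+ size Bs * \prod_(B <- Bs) (size B)`!%:R
  <= (size vs)`!%:R * (a + 2) ^+ size vs.
Proof.
move=> a0; elim: vs => [|v vs IH] /=.
  by rewrite big_seq1 big_nil /= !mulr1.
rewrite big_flatten/= big_map.
under eq_bigr do rewrite (FdB_extend_sum (fun n => n`!%:R * a ^+ n)).
set k := size vs in IH *.
have -> : k.+1`!%:R * (a + 2) ^+ k.+1
   = (k.+1%:R * (a + 2)) * (k`!%:R * (a + 2) ^+ k) :> R.
  by rewrite factS natrM exprS; ring.
apply: le_trans (ler_wpM2l _ IH); last by rewrite mulr_ge0 ?addr_ge0.
rewrite big_distrr/= big_seq [leRHS]big_seq; apply: ler_sum => Bs hBs.
have [_ h1 h2] := set_partitions_inv (all_predT vs) hBs.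
have := size_le_sumn h1; rewrite size_map h2 -/k => jk.
rewrite mulrA ler_wpM2r ?prodr_ge0// factS natrM exprS.
set j := size Bs in jk *; set w := j`!%:R * a ^+ j.
have w0 : 0 <= w by rewrite mulr_ge0 ?exprn_ge0.
have -> : w * (k + j)%:R + j.+1%:R * j`!%:R * (a * a ^+ j)
   = ((k + j)%:R + j.+1%:R * a) * w by rewrite /w; ring.
rewrite ler_wpM2r// mulrDr [leRHS]addrC lerD//.
  by rewrite -natrM ler_nat mulnC mul2n -addnn leq_add// (leq_trans jk).
by rewrite ler_wpM2r// ler_nat.
Qed.

End PartitionInvariants.

(** * Stability under composition *)

Section Stability.
Variable R : realType.

Lemma prod_class_bound (T : Type) (Bs : seq (seq T)) (c sigma : R) (N : nat -> R) :
  \prod_(B <- Bs) (c * ((size B)`!%:R * sigma ^+ size B * N (size B))) =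
  c ^+ size Bs * \prod_(B <- Bs) (size B)`!%:R * sigma ^+ sumn (map size Bs)
   * \prod_(a <- map size Bs) N a.
Proof.
elim: Bs => [|B Bs IH] /=; first by rewrite !big_nil !mulr1.
by rewrite !big_cons IH exprS exprD; ring.
Qed.

Lemma weight_matrix_max (Lam : set R) (M : R -> nat -> R) l1 l2 :
  weight_matrix Lam M -> Lam l1 -> Lam l2 -> exists l, [/\ Lam l,
    forall k, M l1 k <= M l k & forall k, M l2 k <= M l k].
Proof.
move=> [_ _ _ _ Mmon] L1 L2; exists (Num.max l1 l2).
have L : Lam (Num.max l1 l2) by case: leP.
by split => // k; rewrite Mmon// le_max lexx ?orbT.
Qed.

Lemma coord_bound_le n m (M N : nat -> R) (K : set 'rV[R]_n)
    (f : 'rV[R]_n -> 'rV[R]_m) : (forall k, M k <= N k) ->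
  coord_bound M K f -> coord_bound N K f.
Proof.
move=> MN [rho [B [rho0 B0 H]]]; exists rho, B; split => // x vs c Kx evs.
apply: le_trans (H _ _ _ Kx evs) _; rewrite ler_wpM2l// ler_wpM2l//.
by rewrite mulr_ge0// exprn_ge0// ltW.
Qed.

Lemma FdB_stable (Lam : set R) (M : R -> nat -> R) : weight_matrix Lam M ->
  WM_FdB Lam M -> stable_under_composition Lam M.
Proof.
move=> wM FdB p q r U V W oU oV oW g f [gE gUV] [fE fVW].
have [Mpos M0 _ _ _] := wM.
split; last by move=> x Ux; apply/fVW/gUV.
apply/(in_EWM_coordP _ Mpos oU).
have [gsm gB] := (in_EWM_coordP g Mpos oU).1 gE.
have [fsm fB] := (in_EWM_coordP f Mpos oV).1 fE.
split.
  by move=> c; exact: (smoothS_comp oU gsm gUV (fsm c)).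
move=> K KU cK.
have [l1 [L1 g1]] := gB K KU cK.
have KV : g @` K `<=` V by move=> _ [x Kx <-]; apply/gUV/KU.
have cgK : compact (g @` K).
  apply: continuous_compact => //; apply: continuous_in_subspaceT => x.
  rewrite inE => Kx; apply: differentiable_continuous.
  by apply: differentiable_row => i; exact: (gsm i [::] x (KU _ Kx)).
have [l2 [L2 f2]] := fB _ KV cgK.
(* [WM_FdB] concerns a single weight, so the bounds for g on K and for f on g(K) are brought under a
   common M^l. *)
have [l [Ll l1l l2l]] := weight_matrix_max wM L1 L2.
have [sg [B [sg0 B0 HB]]] := coord_bound_le l1l g1.
have [rho [A [rho0 A0 HA]]] := coord_bound_le l2l f2.
have [mu [Lmu [C [tau [C0 tau0 HC]]]]] := FdB l Ll.
exists mu; split => //.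
(* The cost of one block: q from the sum over coordinates, B from the bound on g, rho from one more
   derivative of f. *)
pose a := q%:R * B * rho.
have a0 : 0 <= a by rewrite !mulr_ge0// ltW.
exists (sg * tau * (a + 2)), (A * C); split.
- by rewrite !mulr_gt0// ltr_wpDl.
- by rewrite mulr_ge0// ltW.
move=> x vs c Kx evs; have Ux := KU _ Kx.
rewrite -[fun y => _]/((fun y => f y ord0 c) \o g).
have [_ ->] := Ds_comp oU gsm gUV vs (fsm c) Ux.
set k := size vs.
apply: le_trans (ler_norm_sum _ _ _) _.
pose w (Bs : seq (seq 'rV[R]_p)) : R :=
  (size Bs)`!%:R * a ^+ size Bs * \prod_(B <- Bs) (size B)`!%:R.
apply: (@le_trans _ _ (\sum_(Bs <- set_partitions vs)
   A * C * (sg * tau) ^+ k * M mu k * w Bs)); last first.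
  rewrite -big_distrr/=.
  have h := set_partitions_sum vs a0.
  apply: le_trans (ler_wpM2l _ h) _.
    rewrite mulr_ge0 ?(ltW (Mpos _ Lmu _))// mulr_ge0 ?exprn_ge0 ?mulr_ge0//;
      exact: ltW.
  by rewrite -/k !exprMn le_eqVlt; apply/predU1P; left; ring.
rewrite big_seq [leRHS]big_seq; apply: ler_sum => Bs hBs.
have [h1 h2 h3] := set_partitions_inv evs hBs.
have := @FdB_term_bound R p q g
  (fun j => A * (j`!%:R * rho ^+ j * M l j))
  (fun j => B * (j`!%:R * sg ^+ j * M l j)) (fun y => f y ord0 c) x.
have nn (D0 s0 : R) : 0 <= D0 -> 0 < s0 -> forall j,
    0 <= D0 * (j`!%:R * s0 ^+ j * M l j).
  move=> d0 s00 j; rewrite mulr_ge0// mulr_ge0 ?(ltW (Mpos _ Ll _))//.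
  by rewrite mulr_ge0// exprn_ge0// ltW.
move=> /(_ (nn _ _ A0 rho0) (nn _ _ B0 sg0)).
move=> /(_ _ _ Bs [::] h1 isT) h.
apply: le_trans (h _ _) _.
- by move=> es hes; apply: HA => //; exists x.
- by move=> B1 i hB1; exact: HB.
rewrite add0n; under eq_bigr do rewrite mulrA.
rewrite prod_class_bound h3 -/k.
have Mc := le_Mcirc (Mpos _ Ll) (M0 _ Ll) h2.
rewrite size_map h3 -/k in Mc.
have {}Mc := le_trans Mc (HC k).
set j := size Bs in Mc *.
have -> : A * (j`!%:R * rho ^+ j * M l j) *
  ((q%:R * B) ^+ j * \prod_(B1 <- Bs) (size B1)`!%:R * sg ^+ k *
   \prod_(a1 <- [seq size i | i <- Bs]) M l a1)
  = A * sg ^+ k * w Bs * (M l j * \prod_(a1 <- [seq size i | i <- Bs]) M l a1).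
  by rewrite /w -/j /a [(q%:R * B * rho) ^+ j]exprMn; ring.
have -> : A * C * (sg * tau) ^+ k * M mu k * w Bs
   = A * sg ^+ k * w Bs * (C * tau ^+ k * M mu k) by rewrite exprMn; ring.
rewrite ler_wpM2l// mulr_ge0//; first by rewrite mulr_ge0// exprn_ge0// ltW.
by rewrite mulr_ge0// ?prodr_ge0// mulr_ge0// exprn_ge0.
Qed.

End Stability.

(** * Weight sequences and holomorphic closedness *)

Section WeightSequences.
Variable R : realType.

Lemma bin_le_exp2 n k : ('C(n, k) <= 2 ^ n)%N.
Proof.
elim: n k => [|n IH] [|k]; rewrite ?bin0 ?bin0n ?expn_gt0//.
by rewrite binS expnS mul2n -addnn leq_add.
Qed.

Lemma expn_le_ffact n k : (n ^ k <= (n + k) ^_ k)%N.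
Proof.
elim: k => [|k IH]; first by rewrite ffactn0.
by rewrite addnS ffactSS expnS leq_mul// (leq_trans (leq_addr k n)).
Qed.

(** A crude Stirling bound: n^n <= (2n)(2n-1)...(n+1) = C(2n,n) n!, and C(2n,n) <= 2^(2n). *)
Lemma expnn_le_fact n : (n ^ n <= 4 ^ n * n`!)%N.
Proof.
apply: leq_trans (expn_le_ffact n n) _; rewrite -bin_ffact leq_mul2r.
by rewrite (leq_trans (bin_le_exp2 _ _)) ?orbT// addnn -mul2n expnM.
Qed.

Lemma fact_le_expnn n : (n`! <= n ^ n)%N.
Proof.
suff H m : (m <= n)%N -> (m`! <= n ^ m)%N by exact: H.
elim: m => [|m IH] mn //; rewrite factS expnS leq_mul// IH//.
exact: ltnW.
Qed.

Variable N : nat -> R.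
Hypotheses (N_gt0 : forall k, 0 < N k) (N0 : N 0%N = 1).
Hypothesis N_lc : forall k, ((k.+1)`!%:R * N k.+1) ^+ 2
           <= (k`!%:R * N k) * ((k.+2)`!%:R * N k.+2).

Definition wm (k : nat) : R := k`!%:R * N k.
Definition wnu (k : nat) : R := wm k.+1 / wm k.

Lemma wm_gt0 k : 0 < wm k.
Proof. by rewrite mulr_gt0// ltr0n fact_gt0. Qed.

Lemma wm0 : wm 0 = 1.
Proof. by rewrite /wm N0 fact0 mulr1. Qed.

Lemma wnu_gt0 k : 0 < wnu k.
Proof. by rewrite divr_gt0 ?wm_gt0. Qed.

Lemma wmS k : wm k.+1 = wnu k * wm k.
Proof. by rewrite /wnu divfK// gt_eqF// wm_gt0. Qed.

Lemma wnu_leS k : wnu k <= wnu k.+1.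
Proof.
rewrite /wnu ler_pdivrMr ?wm_gt0// mulrAC ler_pdivlMr ?wm_gt0// mulrC.
by have := N_lc k; rewrite expr2 [X in _ <= X]mulrC -/(wm k) -/(wm k.+1) -/(wm k.+2).
Qed.

Lemma wnu_le j k : (j <= k)%N -> wnu j <= wnu k.
Proof. by apply: (homo_leq (@lexx _ _) (@le_trans _ _)) => i; exact: wnu_leS. Qed.

(** The supporting line of log m at j, multiplied by nu_j^j so that no negative exponent occurs. It
    is proved by following the increasing quotients nu upwards or downwards from j. *)
Lemma wm_wnu j k : wm j * wnu j ^+ k <= wm k * wnu j ^+ j.
Proof.
have [jk|/ltnW kj] := leqP j k.
  have H d : wm j * wnu j ^+ d <= wm (j + d).
    elim: d => [|d IH]; first by rewrite expr0 mulr1 addn0.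
    rewrite exprS [leLHS]mulrCA addnS wmS; apply: ler_pM => //.
    - exact: ltW (wnu_gt0 _).
    - by rewrite mulr_ge0 ?exprn_ge0 ?(ltW (wnu_gt0 _)) ?(ltW (wm_gt0 _)).
    - by rewrite wnu_le// leq_addr.
  have := H (k - j)%N; rewrite (subnKC jk) => Hk.
  have -> : wnu j ^+ k = wnu j ^+ (k - j) * wnu j ^+ j by rewrite -exprD subnK.
  by rewrite mulrA ler_wpM2r// exprn_ge0// (ltW (wnu_gt0 _)).
have H d : wm (k + d) <= wm k * wnu (k + d) ^+ d.
  elim: d => [|d IH]; first by rewrite expr0 mulr1 addn0.
  rewrite addnS wmS exprS [leRHS]mulrCA; apply: ler_pM.
  - exact: ltW (wnu_gt0 _).
  - exact: ltW (wm_gt0 _).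
  - exact: wnu_leS.
  apply: (le_trans IH); rewrite ler_wpM2l ?(ltW (wm_gt0 _))//.
  by rewrite lerXn2r ?nnegrE ?(ltW (wnu_gt0 _)) ?wnu_leS.
have := H (j - k)%N; rewrite (subnKC kj) => Hj.
have -> : wnu j ^+ j = wnu j ^+ (j - k) * wnu j ^+ k by rewrite -exprD subnK.
by rewrite mulrA ler_wpM2r// exprn_ge0// (ltW (wnu_gt0 _)).
Qed.

(** The supporting line at j evaluated at 0, where m_0 = 1, gives m_j <= nu_j^j; multiplying by
    m_j^j yields the claim. *)
Lemma wm_expS j : wm j ^+ j.+1 <= wm j.+1 ^+ j.
Proof.
have := wm_wnu j 0; rewrite expr0 mulr1 wm0 mul1r => h.
rewrite exprS wmS [(wnu j * _) ^+ j]exprMn ler_wpM2r//.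
by rewrite exprn_ge0// (ltW (wm_gt0 _)).
Qed.

Lemma le_root_of_exp (x y : R) (a b : nat) : 0 <= x -> 0 <= y ->
  (0 < a)%N -> (0 < b)%N -> x ^+ b <= y ^+ a ->
  x `^ a%:R^-1 <= y `^ b%:R^-1.
Proof.
move=> x0 y0 a0 b0 h.
rewrite -(@ler_pXn2r _ (a * b)%N) ?nnegrE ?powR_ge0 ?muln_gt0 ?a0//.
rewrite exprM powR_invn_exprn// mulnC exprM powR_invn_exprn//.
Qed.

Lemma wm_root_le j k : (1 <= j)%N -> (j <= k)%N ->
  wm j `^ j%:R^-1 <= wm k `^ k%:R^-1.
Proof.
move=> j1; elim: k => [|k IH]; first by rewrite leqn0 => /eqP E; rewrite E in j1.
rewrite leq_eqVlt => /predU1P[->//|]; rewrite ltnS => jk.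
apply: le_trans (IH jk) _; apply: le_root_of_exp; rewrite ?(ltW (wm_gt0 _))//.
  exact: leq_trans jk.
exact: wm_expS.
Qed.

(** m_k^(1/k) increases, and the factorials change it little: i/4 <= (i!)^(1/i) and (k!)^(1/k) <= k
    <= 2i, whence 8 = 4 * 2. *)
Lemma N_root_le_double i k : (1 <= i)%N -> (i <= k)%N -> (k <= 2 * i)%N ->
  N i `^ i%:R^-1 <= 8 * N k `^ k%:R^-1.
Proof.
move=> i1 ik k2; have := wm_root_le i1 ik; rewrite /wm !powRM ?(ltW (N_gt0 _))//.
set X := N i `^ _; set Y := N k `^ _ => h.
have X0 : 0 <= X by exact: powR_ge0.
have Y0 : 0 <= Y by exact: powR_ge0.
have k1 : (0 < k)%N by exact: leq_trans ik.
have h1 : i%:R / 4 <= i`!%:R `^ i%:R^-1 :> R.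
  rewrite -(@ler_pXn2r _ i) ?nnegrE ?powR_ge0 ?divr_ge0//.
  rewrite powR_invn_exprn// expr_div_n ler_pdivrMr ?exprn_gt0//.
  by rewrite mulrC -!natrX -natrM ler_nat expnn_le_fact.
have h2 : k`!%:R `^ k%:R^-1 <= k%:R :> R.
  rewrite -(@ler_pXn2r _ k) ?nnegrE ?powR_ge0//.
  by rewrite powR_invn_exprn// -natrX ler_nat fact_le_expnn.
have i0 : 0 < i%:R :> R by rewrite ltr0n.
rewrite -(@ler_pM2l _ (i%:R / 4)) ?divr_gt0//.
apply: (@le_trans _ _ (i`!%:R `^ i%:R^-1 * X)); first by rewrite ler_wpM2r.
apply: (le_trans h); apply: (@le_trans _ _ (k%:R * Y)); first by rewrite ler_wpM2r.
have -> : i%:R / 4 * (8 * Y) = (2 * i)%:R * Y by rewrite natrM; field.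
by rewrite ler_wpM2r// ler_nat.
Qed.

End WeightSequences.

(** * Interpolating the root condition from even indices and their multiples *)

Section RootFromMultiples.
Variable R : realType.

Lemma root_le_of_even_multiples (N N' : nat -> R) (B rho : R) :
  (forall k, 0 < N k) -> N 0%N = 1 ->
  (forall k, ((k.+1)`!%:R * N k.+1) ^+ 2
           <= (k`!%:R * N k) * ((k.+2)`!%:R * N k.+2)) ->
  (forall k, 0 < N' k) -> N' 0%N = 1 ->
  (forall k, ((k.+1)`!%:R * N' k.+1) ^+ 2
           <= (k`!%:R * N' k) * ((k.+2)`!%:R * N' k.+2)) ->
  (forall k, N k <= N' k) -> 0 < rho ->
  (forall i m, (1 <= i)%N -> (1 <= m)%N ->
    4^-1 ^+ m.+1 * (2^-1 ^+ (2 * i) * N (2 * i)%N) ^+ m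
      <= B * (rho ^+ (2 * i * m) * N' (2 * i * m)%N)) ->
  exists C : R, 0 < C /\ forall j k, (1 <= j)%N -> (j <= k)%N ->
    N j `^ j%:R^-1 <= C * N' k `^ k%:R^-1.
Proof.
move=> N_gt0 N0 N_lc N'_gt0 N'0 N'_lc NN' rho0 H.
pose B1 := Num.max 1 B.
have B11 : 1 <= B1 by rewrite le_max lexx.
have B10 : 0 < B1 by exact: lt_le_trans B11.
have BB1 : B <= B1 by rewrite le_max lexx orbT.
(* With n = 2im: 2^n undoes the damping 2^-2i, 16^n covers 4^(m+1) since m + 1 <= 2n, and B <= B1^n
   since B1 >= 1. *)
pose C1 := 32 * B1 * rho.
have C10 : 0 < C1 by rewrite !mulr_gt0.
have step i m : (1 <= i)%N -> (1 <= m)%N ->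
    N (2 * i)%N `^ (2 * i)%:R^-1 <= C1 * N' (2 * i * m)%N `^ (2 * i * m)%:R^-1.
  move=> i1 m1; set j := (2 * i)%N; have j0 : (0 < j)%N by rewrite muln_gt0.
  have n0 : (0 < j * m)%N by rewrite muln_gt0 j0.
  rewrite -(@ler_pXn2r _ (j * m)) ?nnegrE ?powR_ge0//; last first.
    by rewrite mulr_ge0 ?powR_ge0// ltW.
  rewrite [leRHS]exprMn powR_invn_exprn ?(ltW (N'_gt0 _))//.
  rewrite exprM powR_invn_exprn ?(ltW (N_gt0 _))//.
  have := H i m i1 m1; rewrite -/j exprMn -exprM.
  have -> : 4^-1 ^+ m.+1 * (2^-1 ^+ (j * m) * N j ^+ m)
     = (4 ^+ m.+1 * 2 ^+ (j * m))^-1 * N j ^+ m :> R.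
    by rewrite invfM -!exprVn !mulrA.
  rewrite ler_pdivrMl ?mulr_gt0 ?exprn_gt0// => h; apply: (le_trans h).
  set n := (j * m)%N in n0 *.
  have h4 : 4 ^+ m.+1 <= 16 ^+ n :> R.
    have -> : 16 = 4 ^+ 2 :> R by ring.
    rewrite -exprM ler_weXn2l ?ler1n// (@leq_trans (2 * m))//.
      by rewrite mul2n -addnn -addn1 leq_add2l.
    by rewrite leq_mul2l/= leq_pmull.
  have hB : B <= B1 ^+ n.
    by apply: (le_trans BB1); rewrite -{1}[B1]expr1 ler_weXn2l.
  have X0 : 0 <= rho ^+ n * N' n.
    by rewrite mulr_ge0 ?exprn_ge0 ?(ltW (N'_gt0 _)) ?(ltW rho0).
  apply: (@le_trans _ _ (4 ^+ m.+1 * 2 ^+ n * (B1 ^+ n * (rho ^+ n * N' n)))).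
    by rewrite ler_wpM2l ?mulr_ge0 ?exprn_ge0// ler_wpM2r.
  have -> : C1 ^+ n * N' n = 16 ^+ n * 2 ^+ n * (B1 ^+ n * (rho ^+ n * N' n)).
    rewrite /C1 !exprMn (_ : 32 = 16 * 2 :> R); last by ring.
    by rewrite exprMn; ring.
  rewrite ler_wpM2r ?mulr_ge0 ?exprn_ge0 ?(ltW B10) ?(ltW rho0) ?(ltW (N'_gt0 _))//.
  by rewrite ler_wpM2r ?exprn_ge0.
(* 64 = 8 * 8 pays for rounding j up to an even j' <= 2j and k down to a multiple of j' that is at
   least k/2. The summand 1 covers k < j', which forces k = j. *)
exists (1 + 64 * C1); split; first by rewrite addr_gt0// mulr_gt0.
move=> j k j1 jk.
have Y0 i : 0 <= N' i `^ i%:R^-1 by exact: powR_ge0.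
pose i := (j.+1 %/ 2)%N; pose j' := (2 * i)%N.
have jj' : (j <= j')%N by rewrite /j' /i; lia.
have j'2 : (j' <= 2 * j)%N by rewrite /j' /i; lia.
have j'S : (j' <= j.+1)%N by rewrite /j' /i; lia.
have i1 : (1 <= i)%N by rewrite /i; lia.
have j'0 : (0 < j')%N by rewrite muln_gt0.
have [kj|j'k] := ltnP k j'.
  have -> : k = j.
    by apply/eqP; rewrite eqn_leq jk andbT -ltnS (leq_trans kj).
  apply: (@le_trans _ _ (N' j `^ j%:R^-1)).
    by rewrite ge0_ler_powR ?invr_ge0// nnegrE ltW.
  by rewrite ler_peMl// lerDl mulr_ge0// ltW.
pose m := (k %/ j')%N.
have m1 : (1 <= m)%N by rewrite divn_gt0.
have nk : (j' * m <= k)%N by rewrite mulnC leq_trunc_div.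
have k2n : (k <= 2 * (j' * m))%N.
  have := ltn_ceil k j'0; rewrite -/m mulSn => h.
  have : (j' <= j' * m)%N by rewrite leq_pmulr.
  by rewrite [(m * j')%N]mulnC in h; lia.
apply: (le_trans (N_root_le_double N_gt0 N0 N_lc j1 jj' j'2)).
apply: (@le_trans _ _ (8 * (C1 * N' (j' * m)%N `^ (j' * m)%:R^-1))).
  by rewrite ler_pM2l// step.
have n1 : (1 <= j' * m)%N by rewrite muln_gt0 j'0.
have h8 := N_root_le_double N'_gt0 N'0 N'_lc n1 nk k2n.
apply: (@le_trans _ _ (8 * (C1 * (8 * N' k `^ k%:R^-1)))).
  by rewrite ler_pM2l// ler_pM2l.
have -> : 8 * (C1 * (8 * N' k `^ k%:R^-1)) = 64 * C1 * N' k `^ k%:R^-1 by ring.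
by rewrite ler_wpM2r// lerDr.
Qed.

End RootFromMultiples.

(** * Functions of one variable and Taylor coefficients of products *)

Section OneVariable.
Variable R : realType.

Lemma is_derive_eps (f : R -> R) (t d : R) :
  (forall e, 0 < e -> exists2 r : R, 0 < r & forall h, `|h| < r ->
     `|f (h + t) - f t - h * d| <= e * `|h|) -> is_derive t 1 f d.
Proof.
move=> H.
have cv : h^-1 *: ((f (h *: 1 + t) : R) - f t) @[h --> (0:R)^'] --> d.
  apply/cvgrPdist_le => e e0; have [r r0 Hr] := H e e0; near=> h.
  have h0 : h != 0 by near: h; exact: nbhs_dnbhs_neq.
  have hr : `|h| < r by near: h; exact: dnbhs0_lt.
  have -> : d - h^-1 *: ((f (h *: 1 + t) : R) - f t)
      = - (h^-1 * (f (h + t) - f t - h * d)).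
    by rewrite [h *: 1]mulr1 -[_ *: _]/(_ * _); field.
  rewrite normrN normrM normfV ler_pdivrMl ?normr_gt0// [leRHS]mulrC.
  exact: Hr.
split; first by apply/cvg_ex; exists d.
exact: cvg_lim cv.
Unshelve. all: by end_near. Qed.

Lemma is_derive_quadratic (f : R -> R) (t d C : R) :
  (forall h, `|f (h + t) - f t - h * d| <= C * h ^+ 2) -> is_derive t 1 f d.
Proof.
move=> H; apply: is_derive_eps => e e0.
have C0 : 0 < 1 + `|C| by rewrite ltr_pwDl.
exists (e / (1 + `|C|)); first exact: divr_gt0.
move=> h; rewrite ltr_pdivlMr// => hr; apply: (le_trans (H h)).
rewrite -[h ^+ 2]real_normK ?num_real// expr2 mulrA ler_wpM2r//.
apply: le_trans (ltW hr); rewrite mulrC ler_wpM2l//.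
by rewrite (le_trans (ler_norm _))// lerDr.
Qed.

Lemma coord_derive n (S S' : R -> R) (x : 'rV[R]_n) i (c : R) :
  is_derive (x ord0 i) 1 S (S' (x ord0 i)) ->
  differentiable (fun y : 'rV[R]_n => c * S (y ord0 i)) x /\
  forall v, 'D_v (fun y : 'rV[R]_n => c * S (y ord0 i)) x
    = c * v ord0 i * S' (x ord0 i).
Proof.
move=> [dS ES].
have @f : {linear 'rV[R]_n -> R}.
  by exists (fun N : 'M[R]_(_, _) => N ord0 i); do 2![eexists]; do ?[constructor];
     rewrite ?mxE// => ? *; rewrite ?mxE//; move=> ?; rewrite !mxE.
have cf : continuous f by exact: coord_continuous.
have df : differentiable f x by exact: linear_differentiable.
have dS' : differentiable S (f x) by apply/derivable1_diffP.
have dc : differentiable (S \o f) x by exact: differentiable_comp.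
have -> : (fun y : 'rV[R]_n => c * S (y ord0 i)) = c *: (S \o f) by [].
split; first exact: differentiableZ.
move=> v; rewrite deriveZ; last exact: diff_derivable.
have E1 : 'd f x v = v ord0 i by rewrite diff_lin.
have E2 (w : R) : 'd S (f x) w = w * S' (x ord0 i).
  by rewrite deriv1E// derive1E ES.
rewrite (deriveE _ dc) diff_comp// -[(_ \o _) v]/('d S (f x) ('d f x v)) E1 E2.
by rewrite -[_ *: _]/(c * (v ord0 i * _)) mulrA.
Qed.

(** A direction in 'rV_1 is a scalar and factors out of each derivative; the successive derivatives
    themselves are supplied as the sequence S. *)
Lemma Ds_one_var (T : set R) (S : nat -> R -> R) :
  open T -> (forall k t, T t -> is_derive t 1 (S k) (S k.+1 t)) ->
  let U := [set x : 'rV[R]_1 | T (x ord0 ord0)] in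
  open U /\ forall vs x, U x ->
   differentiable (Ds vs (fun y => S 0%N (y ord0 ord0))) x /\
   Ds vs (fun y => S 0%N (y ord0 ord0)) x =
    (\prod_(v <- vs) v ord0 ord0) * S (size vs) (x ord0 ord0).
Proof.
move=> oT HS U.
have oU : open U.
  rewrite (_ : U = (fun x : 'rV[R]_1 => x ord0 ord0) @^-1` T)//.
  by apply: open_comp => // x _; exact: coord_continuous.
split => //.
have E vs : forall x, U x -> Ds vs (fun y => S 0%N (y ord0 ord0)) x =
    (\prod_(v <- vs) v ord0 ord0) * S (size vs) (x ord0 ord0).
  elim: vs => [|v vs IH] x Ux /=; first by rewrite big_nil mul1r.
  rewrite (@near_eq_derive _ _ _ _ (fun y : 'rV[R]_1 =>
    (\prod_(v <- vs) v ord0 ord0) * S (size vs) (y ord0 ord0))); last first.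
    exact: open_near Ux _.
  have [_ ->] := @coord_derive 1 _ (S (size vs).+1) x ord0
     (\prod_(v <- vs) v ord0 ord0) (HS (size vs) _ Ux).
  by rewrite big_cons [v ord0 ord0 * _]mulrC.
move=> vs x Ux; split; last exact: E.
have [d _] := @coord_derive 1 _ (S (size vs).+1) x ord0
     (\prod_(v <- vs) v ord0 ord0) (HS (size vs) _ Ux).
apply: differentiable_near_eq d; apply: open_near Ux _ => // y Uy.
by rewrite E.
Qed.

Lemma prod_coord_le1 (vs : seq 'rV[R]_1) : all (fun v => enorm v <= 1) vs ->
  `|\prod_(v <- vs) v ord0 ord0| <= 1.
Proof.
elim: vs => [|v vs IH] /=; first by rewrite big_nil normr1.
move=> /andP[hv /IH h]; rewrite big_cons normrM mulr_ile1//.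
exact: le_trans (enorm_coord _ _) hv.
Qed.

(* Taylor coefficients of a product: the normalisation by factorials turns the
   Leibniz rule into a Cauchy product *)
Lemma cauchy_product_derive (A B : nat -> R -> R) (k : nat) (t : R) :
  (forall k (t : R), is_derive t 1 (A k) (k.+1%:R * A k.+1 t)) ->
  (forall k (t : R), is_derive t 1 (B k) (k.+1%:R * B k.+1 t)) ->
  is_derive t 1 (fun s => \sum_(i < k.+1) A i s * B (k - i)%N s)
    (k.+1%:R * \sum_(i < k.+2) A i t * B (k.+1 - i)%N t).
Proof.
move=> dA dB.
pose F (i : 'I_k.+1) := A i * B (k - i)%N.
have -> : (fun s => \sum_(i < k.+1) A i s * B (k - i)%N s) = \sum_(i < k.+1) F i.
  by apply/funext => s; rewrite fct_sumE.
have dF (i : 'I_k.+1) : is_derive t 1 (F i)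
    (i.+1%:R * A i.+1 t * B (k - i)%N t
     + (k - i).+1%:R * A i t * B (k - i).+1 t).
  have [d1 e1] := dA i t; have [d2 e2] := dB (k - i)%N t.
  apply: DeriveDef; first exact: derivableM.
  by rewrite deriveM// e1 e2 -![_ *: _]/(_ * _); ring.
apply: (is_derive_eq (is_derive_sum dF)).
rewrite big_split/= [X in _ = X]mulr_sumr.
have -> : \sum_(i < k.+1) i.+1%:R * A i.+1 t * B (k - i)%N t
   = \sum_(i < k.+2) i%:R * (A i t * B (k.+1 - i)%N t).
  rewrite [RHS]big_ord_recl mul0r add0r; apply: eq_bigr => i _.
  by rewrite /= /bump add1n subSS mulrA.
have -> : \sum_(i < k.+1) (k - i).+1%:R * A i t * B (k - i).+1 t
   = \sum_(i < k.+2) (k.+1 - i)%:R * (A i t * B (k.+1 - i)%N t).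
  rewrite [RHS]big_ord_recr/= subnn mul0r addr0; apply: eq_bigr => i _.
  by rewrite subSn ?mulrA// -ltnS.
rewrite -big_split/=; apply: eq_bigr => i _.
by rewrite -mulrDl -natrD subnKC// -ltnS.
Qed.

(** If the coefficient of order k is a constant function, its derivative, k + 1 times the next
    coefficient, vanishes; the induction starts from the constant product. *)
Lemma cauchy_product_eq0 (A B : nat -> R -> R) (c : R) :
  (forall k (t : R), is_derive t 1 (A k) (k.+1%:R * A k.+1 t)) ->
  (forall k (t : R), is_derive t 1 (B k) (k.+1%:R * B k.+1 t)) ->
  (forall t, A 0%N t * B 0%N t = c) ->
  forall k t, \sum_(i < k.+2) A i t * B (k.+1 - i)%N t = 0.
Proof.
move=> dA dB E.
have step k : (exists c, forall t, \sum_(i < k.+1) A i t * B (k - i)%N t = c) ->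
    forall t, \sum_(i < k.+2) A i t * B (k.+1 - i)%N t = 0.
  move=> [c0 E0] t.
  have [_] := cauchy_product_derive k t dA dB.
  have -> : (fun s => \sum_(i < k.+1) A i s * B (k - i)%N s) = cst c0.
    by apply/funext => s; rewrite E0.
  by rewrite derive_cst => /esym/eqP; rewrite mulf_eq0 pnatr_eq0/= => /eqP.
elim => [|k IH]; apply: step.
  by exists c => t; rewrite big_ord1 subn0.
by exists 0.
Qed.

Lemma sum_even_terms (F : nat -> R) l : (forall i, F i.*2.+1 = 0) ->
  \sum_(i < l.*2.+1) F i = \sum_(i < l.+1) F i.*2.
Proof.
move=> F0; elim: l => [|l IH]; first by rewrite !big_ord1.
by rewrite doubleS [LHS]big_ord_recr big_ord_recr/= IH [RHS]big_ord_recr/= F0 addr0 doubleS.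
Qed.

End OneVariable.

(** * A cosine series with prescribed growth of derivatives *)

Section CosineSeries.
Variable R : realType.

(** Steps of two match cos'' = -cos, so bounds and values at 0 follow by two-step induction. *)
Fixpoint cosd (k : nat) : R -> R :=
  match k with
  | 0 => @cos R
  | 1 => fun y => - sin y
  | k'.+2 => fun y => - cosd k' y
  end%N.

Lemma nat_ind2 (P : nat -> Prop) : P 0%N -> P 1%N ->
  (forall k, P k -> P k.+2) -> forall k, P k.
Proof.
move=> P0 P1 PS k; suff [] : P k /\ P k.+1 by [].
by elim: k => [|k [h1 h2]]; split => //; exact: PS.
Qed.

Lemma cosd_derive k (y : R) : is_derive y 1 (cosd k) (cosd k.+1 y).
Proof.
elim/nat_ind2: k => [||k IH].
- exact: is_derive_cos.
- exact: (is_deriveN (is_derive_sin y)).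
- exact: (is_deriveN IH).
Qed.

Lemma cosd_le1 k y : `|cosd k y| <= 1.
Proof.
by elim/nat_ind2: k => [||k IH] /=; rewrite ?normrN ?cos_max ?sin_max.
Qed.

Lemma cosd_even0 l : cosd l.*2 0 = (-1) ^+ l.
Proof.
by elim: l => [|l IH]; rewrite /= ?cos0// IH exprS mulN1r.
Qed.

Lemma cosd_odd0 l : cosd l.*2.+1 0 = 0.
Proof.
by elim: l => [|l IH]; rewrite /= ?sin0 ?oppr0//; rewrite /= in IH; rewrite IH oppr0.
Qed.

Lemma cosd_taylor k y d : `|cosd k (d + y) - cosd k y - d * cosd k.+1 y| <= d ^+ 2.
Proof.
have E : d + y - y = d by rewrite addrK.
have := @mean_value_ineq R (cosd k) (cosd k.+1) y (d + y) (cosd k.+1 y) `|d|.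
rewrite E [cosd k.+1 y * d]mulrC -expr2 real_normK ?num_real//; apply.
  by move=> s _; exact: cosd_derive.
move=> s hs; apply: le_trans hs.
have := @mean_value_ineq R (cosd k.+1) (cosd k.+2) y s 0 1.
rewrite mul0r subr0 mul1r; apply; first by move=> z _; exact: cosd_derive.
by move=> z _; rewrite subr0 cosd_le1.
Qed.

Lemma series_half_bound (u : nat -> R) (c : R) :
  (forall j, `|u j| <= c * 2^-1 ^+ j) ->
  cvgn (series u) /\ `|limn (series u)| <= 2 * c.
Proof.
move=> H.
have h2 : `|2^-1 : R| < 1 by rewrite ger0_norm; lra.
have cg := @cvg_geometric_series R c 2^-1 h2.
have cgg : cvgn (series (geometric c 2^-1)) by apply/cvg_ex; eexists; exact: cg.
have cn : cvgn [normed series u].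
  by apply: series_le_cvg cgg => // n; rewrite ?normr_ge0// (le_trans _ (H n)).
split; first exact: normed_cvg.
apply: (le_trans (lim_series_norm cn)).
have -> : 2 * c = limn (series (geometric c 2^-1)).
  by rewrite (cvg_lim _ cg)//; field.
by apply: lim_series_le => // n; exact: H.
Qed.

Lemma limn_series_comb (u v w : nat -> R) (h : R) :
  cvgn (series u) -> cvgn (series v) -> cvgn (series w) ->
  limn (series u) - limn (series v) - h * limn (series w) =
  limn (series (fun j => u j - v j - h * w j)).
Proof.
move=> cu cv cw; apply/esym/cvg_lim => //.
have -> : series (fun j => u j - v j - h * w j)
    = (fun n => series u n - series v n - h * series w n).
  apply/funext => n; rewrite /series/= mulr_sumr -!sumrB.
  by apply: eq_bigr => i _.
by apply: cvgB; [apply: cvgB|apply: cvgMl_tmp].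
Qed.

Variable N : nat -> R.
Hypotheses (N_gt0 : forall k, 0 < N k) (N0 : N 0%N = 1).
Hypothesis N_lc : forall k, ((k.+1)`!%:R * N k.+1) ^+ 2
           <= (k`!%:R * N k) * ((k.+2)`!%:R * N k.+2).

Let m := wm N.
Let nu := wnu N.

(** By [wm_wnu] the k-th derivative of the j-th term is at most 2^-j m_k for every k, and its
    amplitude equals 2^-k m_k at j = k. *)
Definition cos_coef (j : nat) : R := 2^-1 ^+ j * (m j / nu j ^+ j).

Lemma cos_coef_bound j k : 0 <= cos_coef j * nu j ^+ k <= m k * 2^-1 ^+ j.
Proof.
have nu0 := wnu_gt0 N_gt0 j; have mj0 := wm_gt0 N_gt0 j.
apply/andP; split.
  rewrite mulr_ge0 ?exprn_ge0 ?(ltW nu0)// mulr_ge0 ?exprn_ge0//.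
  by rewrite divr_ge0 ?exprn_ge0 ?(ltW nu0) ?(ltW mj0).
rewrite /cos_coef -mulrA mulrC ler_wpM2r ?exprn_ge0//.
rewrite mulrAC ler_pdivrMr ?exprn_gt0//.
exact: wm_wnu.
Qed.

Definition cos_series (k : nat) (t : R) : R :=
  limn (series (fun j => cos_coef j * nu j ^+ k * cosd k (nu j * t))).

Let term_bound k t j :
  `|cos_coef j * nu j ^+ k * cosd k (nu j * t)| <= m k * 2^-1 ^+ j.
Proof.
have /andP[h1 h2] := cos_coef_bound j k.
rewrite normrM (ger0_norm h1) (le_trans _ h2)// ler_piMr//.
exact: cosd_le1.
Qed.

Lemma cos_series_bound k t : `|cos_series k t| <= 2 * m k.
Proof. by have [] := series_half_bound (term_bound k t). Qed.

(** The second-order Taylor remainders of the terms are at most 2^-j m_(k+2) h^2 and sum to 2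
    m_(k+2) h^2, a quadratic remainder for the whole series. *)
Lemma cos_series_derive k (t : R) : is_derive t 1 (cos_series k) (cos_series k.+1 t).
Proof.
apply: (@is_derive_quadratic _ _ _ _ (2 * m k.+2)) => h.
have cv k0 t0 := (series_half_bound (term_bound k0 t0)).1.
rewrite /cos_series limn_series_comb//.
set u := (fun j => _).
have ub j : `|u j| <= m k.+2 * h ^+ 2 * 2^-1 ^+ j.
  rewrite /u.
  have -> : cos_coef j * nu j ^+ k * cosd k (nu j * (h + t)) -
    cos_coef j * nu j ^+ k * cosd k (nu j * t) -
    h * (cos_coef j * nu j ^+ k.+1 * cosd k.+1 (nu j * t)) =
    cos_coef j * nu j ^+ k * (cosd k (nu j * h + nu j * t) - cosd k (nu j * t)
      - nu j * h * cosd k.+1 (nu j * t)).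
    by rewrite mulrDr exprS; ring.
  have /andP[h1 _] := cos_coef_bound j k.
  have /andP[_ h2] := cos_coef_bound j k.+2.
  rewrite normrM (ger0_norm h1).
  apply: (le_trans (ler_wpM2l h1 (cosd_taylor _ _ _))).
  have -> : cos_coef j * nu j ^+ k * (nu j * h) ^+ 2
     = cos_coef j * nu j ^+ k.+2 * h ^+ 2 by rewrite !exprS expr0; ring.
  have -> : m k.+2 * h ^+ 2 * 2^-1 ^+ j = m k.+2 * 2^-1 ^+ j * h ^+ 2 by ring.
  by rewrite ler_wpM2r ?sqr_ge0.
have [_] := series_half_bound ub; by rewrite mulrA.
Qed.

Lemma cos_series_odd0 l : cos_series l.*2.+1 0 = 0.
Proof.
rewrite /cos_series; apply: cvg_lim => //.
rewrite (_ : series _ = cst 0); first exact: cvg_cst.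
apply/funext => n; rewrite /series; apply: big1 => j _.
by rewrite (mulr0 (nu j)) cosd_odd0 mulr0.
Qed.

(** At 0 all terms of order 2l have the sign (-1)^l, so nothing cancels and the term j = 2l alone
    gives the bound. *)
Lemma cos_series_even0 l : 2^-1 ^+ l.*2 * m l.*2 <= (-1) ^+ l * cos_series l.*2 0.
Proof.
pose u j := cos_coef j * nu j ^+ l.*2.
have u0 j : 0 <= u j by have /andP[] := cos_coef_bound j l.*2.
have ub j : `|u j| <= m l.*2 * 2^-1 ^+ j.
  by rewrite ger0_norm//; have /andP[] := cos_coef_bound j l.*2.
have [cu _] := series_half_bound ub.
have -> : (-1) ^+ l * cos_series l.*2 0 = limn (series u).
  apply/esym/cvg_lim => //.
  have [cv _] := series_half_bound (term_bound l.*2 0).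
  rewrite (_ : series u = fun n => (-1) ^+ l *
     series (fun j => cos_coef j * nu j ^+ l.*2 * cosd l.*2 (nu j * 0)) n).
    exact: cvgMl_tmp.
  apply/funext => n; rewrite /series/= mulr_sumr; apply: eq_bigr => j _.
  by rewrite mulr0 cosd_even0 mulrCA -expr2 sqrr_sign mulr1.
have -> : 2^-1 ^+ l.*2 * m l.*2 = u l.*2.
  rewrite /u /cos_coef -mulrA divfK// expf_neq0// gt_eqF//.
  exact: wnu_gt0.
apply: (@le_trans _ _ (series u l.*2.+1)).
  by rewrite /series/= big_nat_recr//= lerDr sumr_ge0.
apply: nondecreasing_cvgn_le => //.
by apply: nondecreasing_series => n _ _; exact: u0.
Qed.

End CosineSeries.

(** * The root condition from holomorphic closedness *)

Section HolomorphicallyClosedRoot.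
Variable R : realType.

(** G and H play the coefficients of g and 1 / (4 - g), indexed by half the order and freed of
    signs. As all terms are nonnegative, keeping one in the recurrence gives H_(i+l) >= G_i H_l / 4;
    m such steps start from H_0 >= 1/4. *)
Lemma quotient_coef_lower (G H : nat -> R) : (forall i, 0 <= G i) -> G 0%N < 4 ->
  0 < H 0%N -> (4 - G 0%N) * H 0%N = 1 ->
  (forall l, (4 - G 0%N) * H l.+1 = \sum_(i < l.+1) G i.+1 * H (l - i)%N) ->
  forall i m, (1 <= i)%N -> 4^-1 ^+ m.+1 * G i ^+ m <= H (i * m)%N.
Proof.
move=> G0 G04 H00 H0E HS.
have c0 : 0 < 4 - G 0%N by lra.
have H0 l : 0 <= H l.
  have [n] := ubnP l; elim: n l => // n IH [|l] ln; first exact: ltW.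
  rewrite -(pmulr_rge0 _ c0) HS sumr_ge0// => i _; rewrite mulr_ge0//.
  by apply: IH; rewrite (leq_ltn_trans (leq_subr _ _)).
have le4 l : (4 - G 0%N) * H l <= 4 * H l.
  by rewrite ler_wpM2r//; have := G0 0%N; lra.
have step i l : (1 <= i)%N -> 4^-1 * (G i * H l) <= H (i + l)%N.
  case: i => // i _; rewrite ler_pdivrMl// addSn (le_trans _ (le4 _))// HS.
  have hi : (i < (i + l).+1)%N by rewrite ltnS leq_addr.
  rewrite (bigD1 (Ordinal hi))//= addKn lerDl sumr_ge0// => j _.
  by rewrite mulr_ge0.
move=> i m i1; elim: m => [|m IH].
  rewrite expr1 expr0 mulr1 muln0 -[4^-1]mulr1 ler_pdivrMl//.
  by rewrite -[X in X <= _]H0E.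
rewrite mulnS (le_trans _ (step _ _ i1))// exprS [G i ^+ _]exprS mulrACA.
by rewrite [leRHS]mulrA ler_wpM2l// mulr_ge0.
Qed.

Lemma normalized_derive (f : nat -> R -> R) :
  (forall k (t : R), is_derive t 1 (f k) (f k.+1 t)) ->
  forall k (t : R), is_derive t 1 (fun s => f k s / k`!%:R)
    (k.+1%:R * (f k.+1 t / k.+1`!%:R)).
Proof.
move=> df k t; have [d1 e1] := df k t.
have -> : (fun s => f k s / k`!%:R) = k`!%:R^-1 *: f k.
  by apply/funext => s; rewrite mulrC.
apply: DeriveDef; first exact: derivableZ.
rewrite deriveZ// e1 factS natrM -[_ *: _]/(_ * _).
by rewrite mulrA invfM mulrACA divff// mul1r mulrC.
Qed.

Lemma inv_derivable (z : R[i]) : z != 4 ->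
  derivable ((fun z => (4 - z)^-1) : R[i]^o -> R[i]^o) z 1.
Proof.
move=> z4; apply: derivableV; first by rewrite subr_eq0 eq_sym.
by apply: derivableB; [exact: derivable_cst|exact: derivable_id].
Qed.

Lemma holomorphically_closed_root (Lam : set R) (M : R -> nat -> R) :
  weight_matrix Lam M -> holomorphically_closed Lam M -> WM_root_cond Lam M.
Proof.
move=> wM hc l Ll; have [Mpos M0 Mlc _ Mmon] := wM.
pose S := cos_series (M l).
have dS k (t : R) : is_derive t 1 (S k) (S k.+1 t).
  by apply: cos_series_derive; [exact: Mpos|exact: Mlc].
have bS k t : `|S k t| <= 2 * (k`!%:R * M l k).
  by apply: cos_series_bound; [exact: Mpos|exact: Mlc].
(* |g| <= 2 m_0 = 2, so g stays away from the pole of 1 / (4 - z). *)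
have S4 t : S 0%N t < 4.
  have := bS 0%N t; rewrite fact0 M0// !mulr1 ler_norml; lra.
pose g (x : 'rV[R]_1) : 'rV[R]_1 := const_mx (S 0%N (x ord0 ord0)).
have [_ dsS] := Ds_one_var openT (fun k t _ => dS k t).
have gE c : (fun y => g y ord0 c) = (fun y => S 0%N (y ord0 ord0)).
  by apply/funext => y; rewrite mxE.
have gin : in_EWM Lam M setT g.
  apply/(in_EWM_coordP g Mpos openT); split.
    by move=> c vs x _; rewrite gE; have [] := dsS vs x I.
  move=> K _ _; exists l; split => //; exists 1, 2; split => // x vs c _ evs.
  rewrite gE; have [_ ->] := dsS vs x I.
  rewrite normrM expr1n mulr1 -[leRHS]mul1r ler_pM//.
  exact: prod_coord_le1.
have hE : in_EWM Lam M setT (fun x => C_as_R2 ((4 - (g x ord0 ord0)%:C%C)^-1)).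
  apply: (hc 1%N setT openT g (fun z => (4 - z)^-1) gin).
  exists [set z | z != 4]; split.
  - rewrite (_ : [set z | _] = ~` [set (4 : R[i]^o)]).
      apply: closed_openC; apply: accessible_closed_set1.
      exact: hausdorff_accessible (@norm_hausdorff _ _).
    by apply/seteqP; split => z /=; [move/eqP|move=> h; apply/eqP].
  - move=> x _ /=; rewrite mxE; apply/eqP => /(congr1 (@complex.Re R)) /= E.
    by have := S4 (x ord0 ord0); rewrite E /= ltxx.
  - by move=> z z4; exact: inv_derivable.
have [sH bH] := (in_EWM_coordP _ Mpos openT).1 hE.
(* Coordinate 0 is the real part, which carries the whole quotient since g is real. *)
have {}sH := sH ord0.
set H := (fun y => _) in sH.
have HE x : H x = (4 - S 0%N (x ord0 ord0))^-1.
  rewrite /H [C_as_R2 _ _ _]mxE eqxx [g x ord0 ord0]mxE.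
  have -> : (4 : R[i]) - (S 0%N (x ord0 ord0))%:C%C
      = (4 - S 0%N (x ord0 ord0))%:C%C by rewrite rmorphB rmorph_nat.
  by rewrite -fmorphV.
pose e : 'rV[R]_1 := delta_mx ord0 ord0.
(* The summand 0 is the base point in [is_derive_line]. *)
pose eta k (t : R) := Ds (nseq k e) H (t *: e + 0).
have deta k (t : R) : is_derive t 1 (eta k) (eta k.+1 t).
  apply: is_derive_line; apply: derivableP; apply: diff_derivable.
  exact: sH.
pose b k (t : R) := if k == 0%N then 4 - S 0%N t else - S k t.
have db k (t : R) : is_derive t 1 (b k) (b k.+1 t).
  have [d1 e1] := dS k t; case: k d1 e1 => [|k] d1 e1.
    rewrite (_ : b 0%N = cst 4 - S 0%N)//; apply: DeriveDef.
      by apply: derivableB => //; exact: derivable_cst.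
    by rewrite deriveB ?derive_cst ?e1 ?sub0r//; exact: derivable_cst.
  rewrite (_ : b k.+1 = - S k.+1)//; apply: DeriveDef.
    exact: derivableN.
  by rewrite deriveN// e1.
pose A k t := eta k t / k`!%:R.
pose B k t := b k t / k`!%:R.
have E0 t : B 0%N t * A 0%N t = 1.
  rewrite /A /B /eta /= fact0 !divr1 HE /b /= !mxE /= !mulr1 addr0 divff//.
  by rewrite subr_eq0 gt_eqF.
have CP := cauchy_product_eq0 (normalized_derive db) (normalized_derive deta) E0.
pose sg n : R := (-1) ^+ n.
(* The odd coefficients of g at 0 vanish, so the relation (4 - g) H = 1 closes up on even orders;
   the factors (-1)^i make both sequences nonnegative. *)
pose G i := sg i * S i.*2 0 / (i.*2)`!%:R.
pose Hh i := sg i * A i.*2 0.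
have sg2 n : sg n * sg n = 1 by rewrite -expr2 sqrr_sign.
have AE i : A i.*2 0 = sg i * Hh i by rewrite /Hh mulrA sg2 mul1r.
have BE i : B i.+1.*2 0 = - (sg i.+1 * G i.+1).
  by rewrite /B /b /= /G !mulrA sg2 mul1r mulNr.
have B0E : B 0%N 0 = 4 - G 0%N.
  by rewrite /B /b /G /sg /= fact0 !divr1 expr0 mul1r.
have BO i : B i.*2.+1 0 = 0.
  by rewrite /B /b /= /S cos_series_odd0 oppr0 mul0r.
have f0 n : 0 < n`!%:R :> R by rewrite ltr0n fact_gt0.
have Glow i : 2^-1 ^+ i.*2 * M l i.*2 <= G i.
  rewrite /G ler_pdivlMr// -mulrA [M l _ * _]mulrC.
  by apply: cos_series_even0; [exact: Mpos|exact: Mlc].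
have Gge0 i : 0 <= G i.
  apply: le_trans (Glow i); rewrite mulr_ge0 ?exprn_ge0//.
  exact: ltW (Mpos _ Ll _).
have G04 : G 0%N < 4 by rewrite /G /sg /= fact0 divr1 expr0 mul1r S4.
have HhS n : (4 - G 0%N) * Hh n.+1 = \sum_(i < n.+1) G i.+1 * Hh (n - i)%N.
  have := CP n.*2.+1 0; rewrite -doubleS.
  rewrite (@sum_even_terms R (fun i => B i 0 * A (n.+1.*2 - i)%N 0)); last first.
    by move=> i; rewrite BO mul0r.
  rewrite big_ord_recl /= subn0 B0E AE.
  rewrite (eq_bigr (fun i : 'I_n.+1 => - sg n.+1 * (G i.+1 * Hh (n - i)%N))).
    rewrite -big_distrr/= => E.
    have : sg n.+1 * ((4 - G 0%N) * Hh n.+1 - \sum_(i < n.+1) G i.+1 * Hh (n - i)%N) = 0.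
      by rewrite -[RHS]E; ring.
    by move/eqP; rewrite mulf_eq0 signr_eq0 /= subr_eq0 => /eqP.
  move=> i _; rewrite /bump /= add1n BE -doubleB subSS AE.
  have -> : sg n.+1 = sg i.+1 * sg (n - i)%N.
    by rewrite /sg -exprD addSn subnKC// -ltnS.
  by ring.
have Hh0E : (4 - G 0%N) * Hh 0%N = 1.
  by rewrite -B0E /Hh /sg expr0 mul1r E0.
have Hh0 : 0 < Hh 0%N.
  have c0 : 0 < 4 - G 0%N by rewrite subr_gt0.
  by rewrite -(pmulr_rgt0 _ c0) Hh0E.
have low := quotient_coef_lower Gge0 G04 Hh0 Hh0E HhS.
(* Only derivatives at 0 are compared, so the compact set {0} suffices. *)
have [||mu [Lmu [rho [C [rho0 C0 HC]]]]] := bH [set (0 : 'rV[R]_1)].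
- by [].
- exact: compact_set1.
have up k : `|A k 0| <= C * (rho ^+ k * M mu k).
  have := HC 0 (nseq k e) ord0 erefl; rewrite size_nseq.
  rewrite all_nseq enorm_delta lexx orbT => /(_ isT) h.
  rewrite /A normrM normfV [`|k`!%:R|]ger0_norm ?(ltW (f0 k))//.
  rewrite ler_pdivrMr// /eta scale0r addr0 (le_trans h)//.
  by rewrite le_eqVlt; apply/predU1P; left; ring.
(* The interpolation also compares M^l with the target weight termwise (the case k = j), so nu has
   to dominate l as well as mu. *)
have [nu [Lnu lnu munu]] := weight_matrix_max wM Ll Lmu.
exists nu; split => //.
apply: (@root_le_of_even_multiples R (M l) (M nu) C rho) => //.
- exact: Mpos.
- exact: M0.
- exact: Mlc.
- exact: Mpos.
- exact: M0.
- exact: Mlc.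
move=> i m i1 m1; rewrite -mulnA !mul2n.
apply: (@le_trans _ _ (4^-1 ^+ m.+1 * G i ^+ m)).
  rewrite ler_wpM2l ?exprn_ge0//.
  apply: lerXn2r; [|by rewrite nnegrE|exact: Glow].
  by rewrite nnegrE mulr_ge0 ?exprn_ge0// (ltW (Mpos _ Ll _)).
apply: (le_trans (low i m i1)); apply: (le_trans (ler_norm _)).
rewrite /Hh normrM normr_sign mul1r (le_trans (up _))// ler_wpM2l//.
by rewrite ler_wpM2l ?exprn_ge0 ?(ltW rho0).
Qed.

End HolomorphicallyClosedRoot.

(** * Goursat's theorem and Cauchy estimates *)

Section Goursat.
Variable R : realType.
Notation mu := (@lebesgue_measure R).

Definition RI (f : R -> R) (a b : R) : R := \int[mu]_(x in `[a, b]) f x.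

Lemma RI_integrable (f : R -> R) a b : {within `[a, b], continuous f} ->
  mu.-integrable `[a, b] (EFin \o f).
Proof.
by move=> ?; apply: continuous_compact_integrable => //; exact: segment_compact.
Qed.

Lemma RI_split (f : R -> R) a c b : a <= c -> c <= b ->
  {within `[a, b], continuous f} -> RI f a b = RI f a c + RI f c b.
Proof.
move=> ac cb cf; have i := RI_integrable cf.
have := @Rintegral_itvB R f (BLeft a) (BRight b) c i.
rewrite !bnd_simp => /(_ ac cb).
rewrite Rintegral_itv_obnd_cbnd; last first.
  by apply: integrableS i => //; apply: subset_itvr; rewrite bnd_simp.
by rewrite /RI => <-; rewrite addrC subrK.
Qed.

Lemma RI_cst (c a b : R) : a <= b -> RI (fun=> c) a b = c * (b - a).
Proof.
move=> ab; rewrite /RI Rintegral_cst//=; congr (_ * _).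
rewrite lebesgue_measure_itv/= lte_fin.
move: ab; rewrite le_eqVlt => /predU1P[->|ab]; first by rewrite ltxx subrr.
by rewrite ab.
Qed.

Lemma RI_near_cst (f : R -> R) (a b c e : R) : a <= b ->
  {within `[a, b], continuous f} ->
  (forall x, a <= x <= b -> `|f x - c| <= e) ->
  `|RI f a b - c * (b - a)| <= e * (b - a).
Proof.
move=> ab cf H; have i := RI_integrable cf.
have ic r : mu.-integrable `[a, b] (EFin \o (fun _ : R => r)).
  by apply: RI_integrable; apply: continuous_subspaceT => x; exact: cvg_cst.
have h1 : RI (fun=> c - e) a b <= RI f a b.
  apply: le_Rintegral => // x; rewrite /= in_itv/= => /H.
  by rewrite ler_norml; lra.
have h2 : RI f a b <= RI (fun=> c + e) a b.
  apply: le_Rintegral => // x; rewrite /= in_itv/= => /H.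
  by rewrite ler_norml; lra.
by move: h1 h2; rewrite !RI_cst// ler_norml mulrBl mulrDl; lra.
Qed.

Lemma RIB (f g : R -> R) a b : {within `[a, b], continuous f} ->
  {within `[a, b], continuous g} ->
  RI (fun x => f x - g x) a b = RI f a b - RI g a b.
Proof. by move=> cf cg; rewrite /RI RintegralB//; exact: RI_integrable. Qed.

(** Total differentiability at (x, y) with partial derivatives p and q, the remainder being measured
    in the l^1 norm. *)
Definition diff2 (P : R -> R -> R) (x y p q : R) : Prop :=
  forall e, 0 < e -> exists2 d : R, 0 < d & forall x' y',
    `|x' - x| < d -> `|y' - y| < d ->
    `|P x' y' - P x y - p * (x' - x) - q * (y' - y)|
      <= e * (`|x' - x| + `|y' - y|).

Lemma diff2_cont1 P x y p q : diff2 P x y p q ->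
  {for x, continuous (fun t => P t y)}.
Proof.
move=> /(_ 1 ltr01)[d d0 H].
apply/cvgrPdist_le => e e0.
apply/nbhs_ballP; exists (Num.min d (e / (1 + `|p|))).
  by rewrite /= lt_min d0 divr_gt0// ltr_pwDl.
move=> t; rewrite /ball_/= lt_min distrC => /andP[h1 h2].
have := H t y h1; rewrite !subrr normr0 mulr0 subr0 addr0 mul1r => /(_ d0) h.
rewrite distrC.
have -> : P t y - P x y = (P t y - P x y - p * (t - x)) + p * (t - x) by ring.
rewrite (le_trans (ler_normD _ _))// (@le_trans _ _ ((1 + `|p|) * `|t - x|))//.
  by rewrite mulrDl mul1r lerD// normrM.
by rewrite mulrC -ler_pdivlMr ?ltr_pwDl// ltW.
Qed.

Lemma diff2_swap P x y p q : diff2 P x y p q -> diff2 (fun y x => P x y) y x q p.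
Proof.
move=> H e e0; have [d d0 Hd] := H e e0; exists d => // x' y' h1 h2.
have := Hd _ _ h2 h1; rewrite [leRHS]mulrC (addrC `|_|) mulrC.
by congr (`|_| <= _); ring.
Qed.

(** The integral of P dx + Q dy along the boundary of [a, b] x [c, d], counterclockwise. *)
Definition rect_int (P Q : R -> R -> R) (t : R * R * R * R) : R :=
  let: (a, b, c, d) := t in
  RI (fun x => P x c) a b - RI (fun x => P x d) a b
  + RI (fun y => Q b y) c d - RI (fun y => Q a y) c d.

Lemma nested_intervals (a b : nat -> R) :
  (forall n, a n <= a n.+1) -> (forall n, b n.+1 <= b n) ->
  (forall n, a n <= b n) -> exists x, forall n, a n <= x <= b n.
Proof.
move=> Ha Hb Hab.
have am : {homo a : m n / (m <= n)%N >-> m <= n} by exact: homo_leq le_trans _.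
have bm : {homo b : m n / (m <= n)%N >-> n <= m}.
  by apply: homo_leq => // ? ? ? ? h; exact: le_trans h _.
have ab m n : a m <= b n.
  rewrite (le_trans (am _ _ (leq_maxl m n)))// (le_trans (Hab _))//.
  by rewrite bm// leq_maxr.
exists (sup (range a)) => n; apply/andP; split.
  apply: ub_le_sup; last by exists n.
  by exists (b 0%N) => _ [m _ <-].
by apply: ge_sup; [exists (a 0%N), 0%N | move=> _ [m _ <-]].
Qed.

Section Bisection.
Variables (P Q : R -> R -> R) (a0 b0 c0 d0 : R).
(** The shared q says that P_y = Q_x: the form P dx + Q dy is closed pointwise, as the
    Cauchy-Riemann equations provide. *)
Hypothesis closed_form : forall x y, a0 <= x <= b0 -> c0 <= y <= d0 ->
  exists p q r, diff2 P x y p q /\ diff2 Q x y q r.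

Let contP a b y : a0 <= a -> b <= b0 -> c0 <= y <= d0 ->
  {within `[a, b], continuous (fun x => P x y)}.
Proof.
move=> ha hb hy; apply: continuous_in_subspaceT => x; rewrite inE/= in_itv/= => hx.
have [||p [q [r [h _]]]] := @closed_form x y => //; first by lra.
exact: diff2_cont1 h.
Qed.

Let contQ c d x : c0 <= c -> d <= d0 -> a0 <= x <= b0 ->
  {within `[c, d], continuous (fun y => Q x y)}.
Proof.
move=> ha hb hy; apply: continuous_in_subspaceT => y; rewrite inE/= in_itv/= => hx.
have [||p [q [r [_ h]]]] := @closed_form x y => //; first by lra.
exact: diff2_cont1 (diff2_swap h).
Qed.

Let inside (t : R * R * R * R) := let: (a, b, c, d) := t in
  [/\ a0 <= a, a <= b, b <= b0 & [/\ c0 <= c, c <= d & d <= d0]].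
Let width (t : R * R * R * R) := let: (a, b, c, d) := t in (b - a) + (d - c).
Let J := rect_int P Q.

Let J_quarters a b c d (m := (a + b) / 2) (n := (c + d) / 2) :
  inside (a, b, c, d) ->
  J (a, b, c, d) = J (a, m, c, n) + J (m, b, c, n) + J (a, m, n, d) + J (m, b, n, d).
Proof.
move=> /= [h1 h2 h3 [h4 h5 h6]]; rewrite /J /rect_int.
have am : a <= m by rewrite /m; lra.
have mb : m <= b by rewrite /m; lra.
have cn : c <= n by rewrite /n; lra.
have nd : n <= d by rewrite /n; lra.
rewrite (@RI_split (fun x => P x c) a m b)//; last by apply: contP => //; lra.
rewrite (@RI_split (fun x => P x d) a m b)//; last by apply: contP => //; lra.
rewrite (@RI_split (fun x => Q b x) c n d)//; last by apply: contQ => //; lra.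
rewrite (@RI_split (fun x => Q a x) c n d)//; last by apply: contQ => //; lra.
by ring.
Qed.

(** The affine parts of P and Q at (x, y) contribute q (c - d)(b - a) and q (b - a)(d - c), which
    cancel. What remains are differences of two errors of size e w, integrated over sides of total
    length w. *)
Let J_local x y e : a0 <= x <= b0 -> c0 <= y <= d0 -> 0 < e ->
  exists2 r, 0 < r & forall a b c d, inside (a, b, c, d) ->
    a <= x <= b -> c <= y <= d -> width (a, b, c, d) < r ->
    `|J (a, b, c, d)| <= 2 * e * width (a, b, c, d) ^+ 2.
Proof.
move=> hx hy e0; have [p [q [s [hP hQ]]]] := closed_form hx hy.
have [r1 r10 H1] := hP e e0; have [r2 r20 H2] := hQ e e0.
exists (Num.min r1 r2); first by rewrite lt_min r10.
move=> a b c d; rewrite /inside /width => -[h1 h2 h3 [h4 h5 h6]] xab ycd.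
rewrite lt_min => /andP[w1 w2]; set w := b - a + (d - c) in w1 w2 *.
have -> : J (a, b, c, d) = RI (fun x => P x c - P x d) a b
    + RI (fun y => Q b y - Q a y) c d.
  rewrite /J /= !RIB; try (by apply: contP => //; lra);
    try (by apply: contQ => //; lra).
  by rewrite addrA.
have nx x' : a <= x' <= b -> `|x' - x| <= b - a by move=> ?; rewrite ler_norml; lra.
have ny y' : c <= y' <= d -> `|y' - y| <= d - c by move=> ?; rewrite ler_norml; lra.
have w0 : 0 <= w by rewrite /w; lra.
have B1 x' y' : a <= x' <= b -> c <= y' <= d ->
    `|P x' y' - P x y - p * (x' - x) - q * (y' - y)| <= e * w.
  move=> hx' hy'; have := nx _ hx'; have := ny _ hy' => i1 i2.
  have j1 : 0 <= b - a by lra.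
  have j2 : 0 <= d - c by lra.
  apply: (@le_trans _ _ (e * (`|x' - x| + `|y' - y|))).
    by apply: H1; apply: le_lt_trans w1; rewrite /w; lra.
  by rewrite ler_wpM2l ?(ltW e0)// /w lerD.
have B2 x' y' : a <= x' <= b -> c <= y' <= d ->
    `|Q x' y' - Q x y - q * (x' - x) - s * (y' - y)| <= e * w.
  move=> hx' hy'; have := nx _ hx'; have := ny _ hy' => i1 i2.
  have j1 : 0 <= b - a by lra.
  have j2 : 0 <= d - c by lra.
  apply: (@le_trans _ _ (e * (`|x' - x| + `|y' - y|))).
    by apply: H2; apply: le_lt_trans w2; rewrite /w; lra.
  by rewrite ler_wpM2l ?(ltW e0)// /w lerD.
have I1 : `|RI (fun x => P x c - P x d) a b - q * (c - d) * (b - a)|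
    <= 2 * e * w * (b - a).
  apply: RI_near_cst => //.
    move=> z; apply: continuousB; apply: contP => //; lra.
  move=> x' hx'; have := B1 x' c hx' _; have := B1 x' d hx' _.
  rewrite !ler_norml => /(_ _)/andP[|i1 i2]; first lra.
  move=> /(_ _)/andP[|i3 i4]; first lra.
  by move: i1 i2 i3 i4; lra.
have I2 : `|RI (fun y => Q b y - Q a y) c d - q * (b - a) * (d - c)|
    <= 2 * e * w * (d - c).
  apply: RI_near_cst => //.
    move=> z; apply: continuousB; apply: contQ => //; lra.
  move=> y' hy'; have := B2 b y' _ hy'; have := B2 a y' _ hy'.
  rewrite !ler_norml => /(_ _)/andP[|i1 i2]; first lra.
  move=> /(_ _)/andP[|i3 i4]; first lra.
  by move: i1 i2 i3 i4; lra.
have -> : 2 * e * w ^+ 2 = 2 * e * w * (b - a) + 2 * e * w * (d - c).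
  by rewrite /w; ring.
move: I1 I2; rewrite !ler_norml => /andP[i1 i2] /andP[i3 i4].
have E : q * (c - d) * (b - a) = - (q * (b - a) * (d - c)) by ring.
by rewrite E in i1 i2; move: i1 i2 i3 i4; lra.
Qed.

Lemma goursat : a0 <= b0 -> c0 <= d0 -> rect_int P Q (a0, b0, c0, d0) = 0.
Proof.
move=> ab0 cd0; apply/eqP; rewrite -normr_le0.
set t0 := (a0, b0, c0, d0).
(* The squared width falls to a quarter under bisection while the number of pieces grows fourfold,
   so a violation of this bound is inherited by some quarter. *)
suff H eta : 0 < eta -> `|J t0| <= eta * width t0 ^+ 2.
  apply/ler_addgt0Pl => e e0; rewrite addr0.
  have w0 : 0 < 1 + width t0 ^+ 2 by rewrite ltr_pwDl// sqr_ge0.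
  rewrite (le_trans (H (e / (1 + width t0 ^+ 2)) _)) ?divr_gt0//.
  by rewrite -mulrA ler_piMr ?(ltW e0)// ler_pdivrMl// mulr1 lerDr.
move=> eta0; rewrite leNgt; apply/negP => bad0.
pose bad t := eta * width t ^+ 2 < `|J t|.
pose nxt (t : R * R * R * R) := let: (a, b, c, d) := t in
  let m := (a + b) / 2 in let n := (c + d) / 2 in
  if bad (a, m, c, n) then (a, m, c, n) else
  if bad (m, b, c, n) then (m, b, c, n) else
  if bad (a, m, n, d) then (a, m, n, d) else (m, b, n, d).
have step t : inside t -> bad t -> [/\ inside (nxt t), bad (nxt t),
    width (nxt t) = width t / 2 &
    [/\ t.1.1.1 <= (nxt t).1.1.1, (nxt t).1.1.2 <= t.1.1.2,
     t.1.2 <= (nxt t).1.2 & (nxt t).2 <= t.2]].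
  case: t => [[[a b] c] d] ins bt; have E := J_quarters ins.
  move: (ins); rewrite /inside => -[h1 h2 h3 [h4 h5 h6]]; rewrite /nxt.
  set m := (a + b) / 2 in E *; set n := (c + d) / 2 in E *.
  have am : a <= m by rewrite /m; lra.
  have mb : m <= b by rewrite /m; lra.
  have cn : c <= n by rewrite /n; lra.
  have nd : n <= d by rewrite /n; lra.
  have W1 : m - a + (n - c) = (b - a + (d - c)) / 2 by rewrite /m /n; field.
  have W2 : b - m + (n - c) = (b - a + (d - c)) / 2 by rewrite /m /n; field.
  have W3 : m - a + (d - n) = (b - a + (d - c)) / 2 by rewrite /m /n; field.
  have W4 : b - m + (d - n) = (b - a + (d - c)) / 2 by rewrite /m /n; field.
  case: ifPn => b1; [|case: ifPn => b2; [|case: ifPn => b3]].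
  - by split => //=; split => //; try split; lra.
  - by split => //=; split => //; try split; lra.
  - by split => //=; split => //; try split; lra.
  (* When the other three quarters satisfy the bound, the last one must violate it: four times eta
     (w/2)^2 is eta w^2. *)
  split => //=; try (by split => //; try split; lra).
  rewrite /bad ltNge; apply/negP => b4.
  move: bt b1 b2 b3; rewrite /bad -!leNgt E /width W1 W2 W3.
  rewrite /width W4 in b4; move: b4.
  set w := b - a + (d - c).
  move=> b4 bt b1 b2 b3; move: bt; apply/negP; rewrite -leNgt.
  rewrite (le_trans (ler_normD _ _))//.
  have := ler_normD (J (a, m, c, n) + J (m, b, c, n)) (J (a, m, n, d)).
  have := ler_normD (J (a, m, c, n)) (J (m, b, c, n)).
  have E4 : eta * w ^+ 2 = 4 * (eta * (w / 2) ^+ 2) by field.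
  by move: b1 b2 b3 b4; rewrite E4; lra.
pose t n := iter n nxt t0.
have T n : inside (t n) /\ bad (t n).
  elim: n => [|n [i b]]; first by split => //=.
  by have [] := step _ i b.
have Wn n : width (t n) = width t0 / 2 ^+ n.
  elim: n => [|n IH]; first by rewrite expr0 divr1.
  have [i b] := T n; have [_ _ W _] := step _ i b.
  by rewrite /t iterS -/(t n) W IH exprSr invfM mulrA.
have [x Hx] : exists x, forall n, (t n).1.1.1 <= x <= (t n).1.1.2.
  apply: nested_intervals => n; have [i b] := T n.
  - by have [_ _ _ []] := step _ i b.
  - by have [_ _ _ []] := step _ i b.
  - by move: i; case: (t n) => [[[? ?] ?] ?] [].
have [y Hy] : exists y, forall n, (t n).1.2 <= y <= (t n).2.
  apply: nested_intervals => n; have [i b] := T n.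
  - by have [_ _ _ []] := step _ i b.
  - by have [_ _ _ []] := step _ i b.
  - by move: i; case: (t n) => [[[? ?] ?] ?] [_ _ _ []].
(* Halving eta compensates the factor 2 in [J_local], which then contradicts the strict inequality
   in [bad]. *)
have e2 : 0 < eta / 2 by lra.
have [r r0 Hr] := J_local (Hx 0%N) (Hy 0%N) e2.
have [n Hn] : exists n, width t0 / 2 ^+ n < r.
  have : (fun n => width t0 * (2^-1) ^+ n) @ \oo --> width t0 * 0.
    by apply: cvgMl_tmp; apply: cvg_expr; rewrite ger0_norm; lra.
  rewrite mulr0 => /cvgrPdist_lt/(_ _ r0)[n _ /(_ n (leqnn n))/=].
  by rewrite sub0r normrN => h; exists n; rewrite -exprVn (le_lt_trans (ler_norm _)).
case E : (t n) => [[[a b] c] d].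
have [ii bb] := T n; have W := Wn n; rewrite E in ii bb W.
have hx := Hx n; have hy := Hy n; rewrite E /= in hx hy.
have := Hr _ _ _ _ ii hx hy; rewrite W => /(_ Hn) h1.
move: bb; rewrite /bad W => h2.
have := lt_le_trans h2 h1.
have -> : 2 * (eta / 2) = eta by field.
by rewrite ltxx.
Qed.

End Bisection.
End Goursat.

(** * Complex differentiability and the exponential *)

Section ComplexDifferentiation.
Variable R : realType.
Local Notation C := R[i].

(** The norm of R[i] takes its values in R[i]; its real part is the modulus as an element of the
    totally ordered field R. *)
Definition cnorm (z : C) : R := complex.Re `|z|.

Lemma cnormC (z : C) : (cnorm z)%:C%C = `|z|.
Proof. by rewrite /cnorm normc_def. Qed.

Lemma cnormE (z : C) :
  cnorm z = Num.sqrt (complex.Re z ^+ 2 + complex.Im z ^+ 2).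
Proof. by rewrite /cnorm normc_def. Qed.

Lemma cnorm_ge0 z : 0 <= cnorm z.
Proof. by rewrite cnormE sqrtr_ge0. Qed.

Lemma cnormM x y : cnorm (x * y) = cnorm x * cnorm y.
Proof. by apply: complexI; rewrite rmorphM /= !cnormC normrM. Qed.

Lemma cnormD x y : cnorm (x + y) <= cnorm x + cnorm y.
Proof. by rewrite -lecR rmorphD /= !cnormC ler_normD. Qed.

Lemma cnormN x : cnorm (- x) = cnorm x.
Proof. by apply: complexI; rewrite !cnormC normrN. Qed.

Lemma cnormV x : cnorm x^-1 = (cnorm x)^-1.
Proof. by apply: complexI; rewrite fmorphV /= !cnormC normfV. Qed.

Lemma cnorm0 : cnorm 0 = 0.
Proof. by apply: complexI; rewrite cnormC normr0. Qed.

Lemma cnorm_gt0 x : (0 < cnorm x) = (x != 0).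
Proof. by rewrite -ltcR cnormC normr_gt0. Qed.

Lemma Re_le_cnorm z : `|complex.Re z| <= cnorm z.
Proof. by rewrite cnormE -sqrtr_sqr ler_wsqrtr// lerDl sqr_ge0. Qed.

Lemma Im_le_cnorm z : `|complex.Im z| <= cnorm z.
Proof. by rewrite cnormE -sqrtr_sqr ler_wsqrtr// lerDr sqr_ge0. Qed.

Lemma cnorm_real (x : R) : cnorm x%:C%C = `|x|.
Proof. by rewrite cnormE /= expr0n addr0 sqrtr_sqr. Qed.

Lemma cnorm_le_ReIm z : cnorm z <= `|complex.Re z| + `|complex.Im z|.
Proof.
rewrite cnormE -[leRHS]ger0_norm ?addr_ge0// -sqrtr_sqr ler_wsqrtr//.
rewrite sqrrD !real_normK ?num_real// addrAC lerDl.
by rewrite mulrn_wge0// mulr_ge0.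
Qed.

Definition cdiff (f : C -> C) (z d : C) : Prop :=
  forall e : R, 0 < e -> exists2 r : R, 0 < r & forall k, cnorm k < r ->
    cnorm (f (z + k) - f z - k * d) <= e * cnorm k.

Lemma pos_complex (e : C) : 0 < e -> e = (complex.Re e)%:C%C /\ 0 < complex.Re e.
Proof.
by case: e => a b; rewrite ltcE /= => /andP[/eqP -> ->].
Qed.

Lemma derivable_cdiff (f : C -> C) z :
  derivable (f : C^o -> C^o) z 1 -> exists d, cdiff f z d.
Proof.
move=> /cvg_ex[d /cvgrPdist_le H]; exists d => e e0.
have e0' : 0 < e%:C%C by rewrite ltcR.
have /nbhs_ballP[r /= r0 Hr] := H _ e0'.
have [rE rR0] := pos_complex r0.
exists (complex.Re r) => // k kr.
have [->|k0] := eqVneq k 0.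
  by rewrite addr0 subrr mul0r subrr cnorm0 mulr0.
have := Hr k; rewrite -?ball_normE /ball_ /= sub0r normrN -cnormC rE ltcR => /(_ kr k0).
rewrite [k *: 1]mulr1 -cnormC lecR => h.
have -> : f (z + k) - f z - k * d = - k * (d - k^-1 *: (f (k + z) - f z)).
  by rewrite [k + z]addrC -[_ *: _]/(_ * _); field.
by rewrite cnormM cnormN mulrC ler_wpM2r// cnorm_ge0.
Qed.

Lemma cdiff_derivable (f : C -> C) z d :
  cdiff f z d -> derivable (f : C^o -> C^o) z 1.
Proof.
move=> H; apply/cvg_ex; exists d; apply/cvgrPdist_le => e e0.
have [eE eR0] := pos_complex e0.
have [r r0 Hr] := H _ eR0.
apply/nbhs_ballP; exists r%:C%C; first by rewrite /= ltcR.
move=> k; rewrite -?ball_normE /ball_ /= sub0r normrN -cnormC ltcR => kr k0.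
have := Hr k kr; rewrite [k *: 1]mulr1.
have -> : f (z + k) - f z - k * d = - k * (d - k^-1 *: (f (k + z) - f z)).
  by rewrite [k + z]addrC -[_ *: _]/(_ * _); field.
rewrite cnormM cnormN mulrC ler_pM2r ?cnorm_gt0// => h.
by rewrite -cnormC eE lecR.
Qed.

Lemma derivable1_comp (K : numFieldType) (f g : K -> K) (z : K) :
  derivable (g : K^o -> K^o) z 1 -> derivable (f : K^o -> K^o) (g z) 1 ->
  derivable (f \o g : K^o -> K^o) z 1.
Proof.
move=> /derivable1_diffP dg /derivable1_diffP df; apply/derivable1_diffP.
exact: differentiable_comp.
Qed.

Lemma cdiff_comp (f g : C -> C) z d1 d2 : cdiff g z d1 -> cdiff f (g z) d2 ->
  exists d, cdiff (f \o g) z d.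
Proof.
move=> /cdiff_derivable dg /cdiff_derivable df.
by apply: derivable_cdiff; exact: derivable1_comp dg df.
Qed.

Lemma cdiffM (f g : C -> C) z d1 d2 : cdiff f z d1 -> cdiff g z d2 ->
  exists d, cdiff (fun w => f w * g w) z d.
Proof.
move=> /cdiff_derivable df /cdiff_derivable dg; apply: derivable_cdiff.
exact: (derivableM df dg).
Qed.

Lemma cdiff_affine (f : C -> C) z d (a b : C) : cdiff f z d ->
  cdiff (fun w => a * f w + b) z (a * d).
Proof.
move=> H e e0; have a0 : 0 < 1 + cnorm a by rewrite ltr_pwDl// cnorm_ge0.
have [r r0 Hr] := H _ (divr_gt0 e0 a0); exists r => // k kr.
have -> : a * f (z + k) + b - (a * f z + b) - k * (a * d)
   = a * (f (z + k) - f z - k * d) by ring.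
rewrite cnormM; apply: (le_trans (ler_wpM2l (cnorm_ge0 a) (Hr k kr))).
rewrite mulrA ler_wpM2r ?cnorm_ge0// mulrCA ler_piMr ?(ltW e0)//.
by rewrite ler_pdivrMr// mul1r lerDr.
Qed.

Lemma cdiffB (f g : C -> C) z d1 d2 : cdiff f z d1 -> cdiff g z d2 ->
  cdiff (fun w => f w - g w) z (d1 - d2).
Proof.
move=> Hf Hg e e0; have e2 : 0 < e / 2 by lra.
have [r1 r10 H1] := Hf _ e2; have [r2 r20 H2] := Hg _ e2.
exists (Num.min r1 r2); first by rewrite lt_min r10.
move=> k; rewrite lt_min => /andP[k1 k2].
have -> : f (z + k) - g (z + k) - (f z - g z) - k * (d1 - d2) =
  (f (z + k) - f z - k * d1) + - (g (z + k) - g z - k * d2) by ring.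
apply: (le_trans (cnormD _ _)); rewrite cnormN.
by have := H1 k k1; have := H2 k k2; lra.
Qed.

Lemma cdiff_shift (f : C -> C) z k d : cdiff f (z + k) d ->
  cdiff (fun w => f (w + k)) z d.
Proof.
move=> H e e0; have [r r0 Hr] := H e e0; exists r => // h hr.
by rewrite [z + h + k]addrAC; exact: Hr.
Qed.

(** Here and in [cdiff_diff2_Im] the Cauchy-Riemann equations appear: one complex number d
    determines all four partial derivatives. *)
Lemma cdiff_diff2_Re (f : C -> C) (x y : R) d : cdiff f (x +i* y)%C d ->
  diff2 (fun s t => complex.Re (f (s +i* t)%C)) x y (complex.Re d) (- complex.Im d).
Proof.
move=> H e e0; have [r r0 Hr] := H e e0; exists (r / 2); first by lra.
move=> x' y' hx hy; pose k : C := ((x' - x) +i* (y' - y))%C.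
have nk : cnorm k <= `|x' - x| + `|y' - y| by exact: cnorm_le_ReIm.
have kr : cnorm k < r by lra.
have := Hr k kr.
have -> : (x +i* y)%C + k = (x' +i* y')%C.
  by apply/eqP; rewrite eq_complex /= ![_ + (_ - _)]addrC !subrK !eqxx.
move=> h; apply: (@le_trans _ _ (e * cnorm k)); last by rewrite ler_wpM2l ?(ltW e0).
apply: le_trans h; apply: le_trans (Re_le_cnorm _).
rewrite le_eqVlt; apply/predU1P; left; congr `|_|.
rewrite /k; case: (f _) => a b; case: (f _) => a' b'; case: (d) => p q /=.
by ring.
Qed.

Lemma cdiff_diff2_Im (f : C -> C) (x y : R) d : cdiff f (x +i* y)%C d ->
  diff2 (fun s t => complex.Im (f (s +i* t)%C)) x y (complex.Im d) (complex.Re d).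
Proof.
move=> H e e0; have [r r0 Hr] := H e e0; exists (r / 2); first by lra.
move=> x' y' hx hy; pose k : C := ((x' - x) +i* (y' - y))%C.
have nk : cnorm k <= `|x' - x| + `|y' - y| by exact: cnorm_le_ReIm.
have kr : cnorm k < r by lra.
have := Hr k kr.
have -> : (x +i* y)%C + k = (x' +i* y')%C.
  by apply/eqP; rewrite eq_complex /= ![_ + (_ - _)]addrC !subrK !eqxx.
move=> h; apply: (@le_trans _ _ (e * cnorm k)); last by rewrite ler_wpM2l ?(ltW e0).
apply: le_trans h; apply: le_trans (Im_le_cnorm _).
rewrite le_eqVlt; apply/predU1P; left; congr `|_|.
rewrite /k; case: (f _) => a b; case: (f _) => a' b'; case: (d) => p q /=.
by ring.
Qed.

Definition cexp (w : C) : C :=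
  (expR (complex.Re w) * cos (complex.Im w)
   +i* (expR (complex.Re w) * sin (complex.Im w)))%C.

Lemma cexpD w k : cexp (w + k) = cexp w * cexp k.
Proof.
case: w => a b; case: k => c d; apply/eqP; rewrite eq_complex /=.
by rewrite expRD cosD sinD; apply/andP; split; apply/eqP; ring.
Qed.

Lemma cnorm_cexp w : cnorm (cexp w) = expR (complex.Re w).
Proof.
by rewrite cnormE /= !exprMn -mulrDr cos2Dsin2 mulr1 sqrtr_sqr ger0_norm ?expR_ge0.
Qed.

Lemma expR_taylor (a : R) : `|a| <= 1 ->
  `|expR a - 1| <= expR 1 * `|a| /\ `|expR a - 1 - a| <= expR 1 * a ^+ 2.
Proof.
have E1 (s : R) : `|s| <= 1 -> `|expR s - 1| <= expR 1 * `|s|.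
  move=> hs.
  have H z : `|z - 0| <= `|s - 0| -> `|expR z - 0| <= expR 1.
    rewrite !subr0 => hz; rewrite ger0_norm ?expR_ge0// ler_expR.
    by rewrite (le_trans (ler_norm _))// (le_trans hz hs).
  have := mean_value_ineq (fun z _ => is_derive_expR z) H.
  by rewrite expR0 mul0r !subr0.
move=> ha; split; first exact: E1.
have H z : `|z - 0| <= `|a - 0| -> `|expR z - 1| <= expR 1 * `|a|.
  rewrite !subr0 => hz; apply: (le_trans (E1 z (le_trans hz ha))).
  by rewrite ler_wpM2l ?expR_ge0.
have := mean_value_ineq (fun z _ => is_derive_expR z) H.
by rewrite expR0 mul1r !subr0 -mulrA -expr2 real_normK ?num_real.
Qed.

Lemma cexp_taylor k : cnorm k <= 1 ->
  cnorm (cexp k - 1 - k) <= 4 * expR 1 * cnorm k ^+ 2.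
Proof.
move=> k1; have ha := le_trans (Re_le_cnorm k) k1.
have n2 : cnorm k ^+ 2 = complex.Re k ^+ 2 + complex.Im k ^+ 2.
  by rewrite cnormE sqr_sqrtr// addr_ge0 ?sqr_ge0.
rewrite n2; move: ha {n2 k1}; case: k => a b /= ha.
have [e1 e2] := expR_taylor ha.
have c1 : `|cos b - 1| <= b ^+ 2.
  have := @cosd_taylor R 0 0 b; rewrite /= addr0 cos0 sin0 oppr0 mulr0 subr0.
  by [].
have s1 : `|sin b - b| <= b ^+ 2.
  have := @cosd_taylor R 1 0 b; rewrite /= addr0 cos0 sin0 oppr0 subr0.
  by rewrite mulrN1 opprK -normrN opprD opprK.
set K := expR 1 in e1 e2 *; have K0 : 0 <= K by exact: expR_ge0.
have ea : 0 <= expR a <= K.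
  by rewrite expR_ge0 ler_expR (le_trans (ler_norm _)).
have /andP[ea0 eaK] := ea.
apply: (le_trans (cnorm_le_ReIm _)); rewrite /=.
have -> : expR a * cos b - 1 - a = (expR a - 1 - a) + expR a * (cos b - 1) by ring.
have -> : expR a * sin b - 0 - b = expR a * (sin b - b) + (expR a - 1) * b by ring.
have i1 : `|expR a * (cos b - 1)| <= K * b ^+ 2.
  by rewrite normrM (ger0_norm ea0) ler_pM.
have i2 : `|expR a * (sin b - b)| <= K * b ^+ 2.
  by rewrite normrM (ger0_norm ea0) ler_pM.
have i3 : `|(expR a - 1) * b| <= K * (a ^+ 2 + b ^+ 2).
  rewrite normrM (le_trans (ler_wpM2r (normr_ge0 b) e1))// -mulrA ler_wpM2l//.
  rewrite -[a ^+ 2]real_normK ?num_real// -[b ^+ 2]real_normK ?num_real//.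
  have := sqr_ge0 (`|a| - `|b|); have := normr_ge0 a; have := normr_ge0 b; nra.
have := ler_normD (expR a - 1 - a) (expR a * (cos b - 1)).
have := ler_normD (expR a * (sin b - b)) ((expR a - 1) * b).
have := mulr_ge0 K0 (sqr_ge0 a); have := mulr_ge0 K0 (sqr_ge0 b).
by move: i1 i2 i3 e2; rewrite !mulrDr; lra.
Qed.

Lemma cdiff_cexp w : cdiff cexp w (cexp w).
Proof.
move=> e e0; set K := 4 * expR 1 * (1 + cnorm (cexp w)).
have K0 : 0 < K.
  by rewrite !mulr_gt0 ?expR_gt0// ltr_pwDl// cnorm_ge0.
exists (Num.min 1 (e / K)); first by rewrite lt_min ltr01 divr_gt0.
move=> k; rewrite lt_min => /andP[k1 k2].
have -> : cexp (w + k) - cexp w - k * cexp w = cexp w * (cexp k - 1 - k).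
  by rewrite cexpD; ring.
rewrite cnormM.
apply: (le_trans (ler_wpM2l (cnorm_ge0 _) (cexp_taylor (ltW k1)))).
rewrite expr2 !mulrA ler_wpM2r ?cnorm_ge0//.
apply: (@le_trans _ _ (K * cnorm k)).
  rewrite ler_wpM2r ?cnorm_ge0// /K.
  have -> : cnorm (cexp w) * 4 * expR 1 = 4 * expR 1 * cnorm (cexp w) by ring.
  by rewrite ler_wpM2l ?mulr_ge0 ?expR_ge0// lerDr.
by rewrite mulrC -ler_pdivlMr// ltW.
Qed.

End ComplexDifferentiation.

Section CauchyEstimates.
Variable R : realType.
Local Notation C := R[i].

Lemma complex_ReB (x y : C) :
  complex.Re (x - y) = complex.Re x - complex.Re y.
Proof. by case: x; case: y. Qed.

Lemma complex_ImB (x y : C) :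
  complex.Im (x - y) = complex.Im x - complex.Im y.
Proof. by case: x; case: y. Qed.

Lemma le_of_eps (x y c : R) : (forall e, 0 < e -> x <= y + c * e) -> x <= y.
Proof.
move=> H; apply/ler_addgt0Pl => e e0; rewrite addrC.
have c0 : 0 < 1 + `|c| by rewrite ltr_pwDl.
apply: (le_trans (H _ (divr_gt0 e0 c0))); rewrite lerD2l mulrCA ler_piMr ?(ltW e0)//.
by rewrite ler_pdivrMr// mul1r (le_trans (ler_norm _))// lerDr.
Qed.

(* Goursat's theorem in logarithmic polar coordinates: the circle means of
   [f (z + e^w) e^-w] do not depend on the radius. *)
Lemma cauchy_estimate0 (f : C -> C) z d (r B : R) : 0 < r ->
  (forall k, cnorm k <= r -> exists d', cdiff f (z + k) d') ->
  (forall k, cnorm k <= r -> cnorm (f (z + k)) <= B) ->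
  f z = 0 -> cdiff f z d -> cnorm d <= 2 * B / r.
Proof.
move=> r0 hf fB fz hd.
pose h (w : C) := f (z + cexp w) * cexp (- w).
have nexp s t : s <= ln r -> cnorm (cexp (s +i* t)%C) <= r.
  by rewrite cnorm_cexp /= -ler_expR lnK.
have hol s t : s <= ln r -> exists d', cdiff h (s +i* t)%C d'.
  move=> sr; have [d1 h1] := hf _ (nexp s t sr).
  have e1 : cdiff (fun w => z + cexp w) (s +i* t)%C (cexp (s +i* t)%C).
    have := cdiff_affine 1 z (@cdiff_cexp R (s +i* t)%C); rewrite mul1r.
    by congr cdiff; apply/funext => w; rewrite mul1r addrC.
  have [d2 h2] := cdiff_comp e1 h1.
  have e2 : cdiff -%R (s +i* t)%C (-1).
    move=> e e0; exists 1 => // k _.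
    by rewrite (_ : _ - _ = 0) ?cnorm0 ?mulr_ge0 ?cnorm_ge0 ?(ltW e0)//; ring.
  have [d3 h3] := cdiff_comp e2 (@cdiff_cexp R (- (s +i* t)%C)).
  exact: cdiffM h2 h3.
pose u s t := complex.Re (h (s +i* t)%C).
pose v s t := complex.Im (h (s +i* t)%C).
have period s : h (s +i* 0)%C = h (s +i* (pi *+ 2))%C.
  rewrite /h; have E : cexp (s +i* 0)%C = cexp (s +i* (pi *+ 2))%C.
    by rewrite /cexp /= cos0 sin0 cos2pi sin2pi.
  rewrite -E; congr (_ * _).
  rewrite /cexp /= oppr0 cos0 sin0 cosN sinN cos2pi sin2pi oppr0.
  by [].
have pi2 : 0 <= pi *+ 2 :> R by rewrite mulrn_wge0// pi_ge0.
(* The imaginary part of h dw is v ds + u dt, and its real part, used in [constV], is u ds - v dt.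
   By periodicity the edges t = 0 and t = 2 pi cancel, leaving the two integrals in t. *)
have constU s : s <= ln r -> RI (u s) 0 (pi *+ 2) = RI (u (ln r)) 0 (pi *+ 2).
  move=> sr; have := @goursat R v u s (ln r) 0 (pi *+ 2).
  rewrite /rect_int => /(_ _ sr pi2) H.
  suff : 0 = RI (u (ln r)) 0 (pi *+ 2) - RI (u s) 0 (pi *+ 2).
    by move/esym/eqP; rewrite subr_eq0 => /eqP ->.
  rewrite -{1}H.
    rewrite (_ : (fun x => v x 0) = (fun x => v x (pi *+ 2))).
      by rewrite subrr add0r.
    by apply/funext => x; rewrite /v period.
  move=> x y /andP[_ xr] _; have [d' h'] := hol x y xr.
  exists (complex.Im d'), (complex.Re d'), (- complex.Im d'); split.
    exact: cdiff_diff2_Im.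
  exact: cdiff_diff2_Re.
have constV s : s <= ln r -> RI (fun t => - v s t) 0 (pi *+ 2)
    = RI (fun t => - v (ln r) t) 0 (pi *+ 2).
  move=> sr; have := @goursat R u (fun s t => - v s t) s (ln r) 0 (pi *+ 2).
  rewrite /rect_int => /(_ _ sr pi2) H.
  suff : 0 = RI (fun t => - v (ln r) t) 0 (pi *+ 2) - RI (fun t => - v s t) 0 (pi *+ 2).
    by move/esym/eqP; rewrite subr_eq0 => /eqP ->.
  rewrite -{1}H.
    rewrite (_ : (fun x => u x 0) = (fun x => u x (pi *+ 2))).
      by rewrite subrr add0r.
    by apply/funext => x; rewrite /u period.
  move=> x y /andP[_ xr] _; have [d' h'] := hol x y xr.
  exists (complex.Re d'), (- complex.Im d'), (- complex.Re d'); split.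
    exact: cdiff_diff2_Re.
  move=> e e0; have [dl dl0 Hd] := cdiff_diff2_Im h' e0.
  exists dl => // x' y' i1 i2; have := Hd _ _ i1 i2; rewrite -normrN.
  by congr (`|_| <= _); rewrite /v; ring.
have contU s : s <= ln r -> {within `[0, pi *+ 2], continuous (u s)}.
  move=> sr; apply: continuous_subspaceT => t; have [d' h'] := hol s t sr.
  exact: diff2_cont1 (diff2_swap (cdiff_diff2_Re h')).
have contV s : s <= ln r -> {within `[0, pi *+ 2], continuous (fun t => - v s t)}.
  move=> sr; apply: continuous_subspaceT => t; have [d' h'] := hol s t sr.
  apply: continuousN.
  exact: diff2_cont1 (diff2_swap (cdiff_diff2_Im h')).
have nh s t : cnorm (h (s +i* t)%C) = cnorm (f (z + cexp (s +i* t)%C)) / expR s.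
  by rewrite /h cnormM cnorm_cexp /= expRN.
have hB t : cnorm (h (ln r +i* t)%C) <= B / r.
  by rewrite nh lnK// ler_wpM2r ?invr_ge0 ?(ltW r0)// fB// nexp.
have p2 : 0 < pi *+ 2 - 0 :> R by rewrite subr0 mulrn_wgt0// pi_gt0.
(* Since f z = 0, h w is the difference quotient of f with increment e^w, which tends to d uniformly
   in the angle as s decreases. *)
have small e : 0 < e -> exists2 s, s <= ln r & forall t, cnorm (h (s +i* t)%C - d) <= e.
  move=> e0; have [dl dl0 Hd] := hd e e0.
  pose q := Num.min r (dl / 2).
  have q0 : 0 < q by rewrite lt_min r0 divr_gt0.
  have qr : q <= r by rewrite ge_min lexx.
  have qd : q < dl by rewrite gt_min; apply/orP; right; lra.
  exists (ln q); first by rewrite ler_ln ?posrE.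
  move=> t; set w := (ln q +i* t)%C.
  have nw : cnorm (cexp w) = q by rewrite cnorm_cexp /= lnK.
  have := Hd (cexp w); rewrite nw fz subr0 => /(_ qd) i1.
  have E1 : cexp w * cexp (- w) = 1.
    rewrite -cexpD subrr /cexp /= expR0 cos0 sin0 mulr1 mulr0.
    by [].
  have -> : h w - d = (f (z + cexp w) - cexp w * d) * cexp (- w).
    by rewrite /h mulrBl mulrAC E1 mul1r.
  rewrite cnormM cnorm_cexp /= expRN lnK// ler_pdivrMr//.
(* The mean over the circle of radius r is at most B / r and equals the mean over a tiny circle,
   which is e-close to c. Using this for both Re d and -Im d gives the factor 2 in the estimate. *)
have mean (U : R -> R -> R) (c : R) :
    (forall s, s <= ln r -> {within `[0, pi *+ 2], continuous (U s)}) ->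
    (forall s, s <= ln r -> RI (U s) 0 (pi *+ 2) = RI (U (ln r)) 0 (pi *+ 2)) ->
    (forall t, `|U (ln r) t| <= B / r) ->
    (forall e, 0 < e -> exists2 s, s <= ln r & forall t, `|U s t - c| <= e) ->
    `|c| <= B / r.
  move=> cU kU bU sU; apply: (@le_of_eps _ _ 1) => e e0; rewrite mul1r.
  have [s sr Hs] := sU e e0.
  have := @RI_near_cst R (U s) 0 (pi *+ 2) c e pi2 (cU s sr) (fun t _ => Hs t).
  have := @RI_near_cst R (U (ln r)) 0 (pi *+ 2) 0 (B / r) pi2 (cU _ (lexx _)).
  rewrite mul0r subr0 (kU s sr).
  set P := pi *+ 2 - 0 in p2 *; set I := RI _ _ _ => i1 i2.
  rewrite -(ler_pM2r p2) mulrDl.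
  have -> : `|c| * P = `|I - (I - c * P)|.
    by rewrite opprB addrC subrK normrM (ger0_norm (ltW p2)).
  apply: (le_trans (ler_normB _ _)); rewrite lerD//.
  by apply: i1 => t _; rewrite subr0.
have nd1 : `|complex.Re d| <= B / r.
  apply: (mean u) => //.
  - by move=> t; apply: le_trans (Re_le_cnorm _) (hB t).
  - move=> e e0; have [s sr Hs] := small e e0; exists s => // t.
    by rewrite /u -complex_ReB; exact: le_trans (Re_le_cnorm _) (Hs t).
have nd2 : `|- complex.Im d| <= B / r.
  apply: (mean (fun s t => - v s t)) => //.
  - by move=> t; rewrite normrN; apply: le_trans (Im_le_cnorm _) (hB t).
  - move=> e e0; have [s sr Hs] := small e e0; exists s => // t.
    rewrite -opprD normrN.
    by rewrite /v -complex_ImB; exact: le_trans (Im_le_cnorm _) (Hs t).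
rewrite normrN in nd2.
by apply: (le_trans (cnorm_le_ReIm _)); rewrite -mulrA; lra.
Qed.

(** Subtracting the value f z makes the function vanish at z and doubles its bound. *)
Lemma cauchy_estimate (f : C -> C) z d (r B : R) : 0 < r ->
  (forall k, cnorm k <= r -> exists d', cdiff f (z + k) d') ->
  (forall k, cnorm k <= r -> cnorm (f (z + k)) <= B) ->
  cdiff f z d -> cnorm d <= 4 * B / r.
Proof.
move=> r0 hf fB hd.
pose g w := 1 * f w + - f z.
have -> : 4 * B / r = 2 * (2 * B) / r by ring.
apply: (@cauchy_estimate0 g z _ r (2 * B) r0).
- by move=> k hk; have [d' h'] := hf k hk; exists (1 * d'); exact: cdiff_affine.
- move=> k hk; rewrite /g mul1r; apply: (le_trans (cnormD _ _)); rewrite cnormN.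
  have := fB k hk; have := fB 0; rewrite addr0 cnorm0 => /(_ (ltW r0)); lra.
- by rewrite /g mul1r subrr.
- by rewrite -[d]mul1r; exact: cdiff_affine.
Qed.

End CauchyEstimates.

(** * The derivative of a holomorphic function is holomorphic *)

Section HolomorphicDerivative.
Variable R : realType.
Local Notation C := R[i].

Lemma complex_ReZ (h : R) (x : C) : complex.Re (h%:C%C * x) = h * complex.Re x.
Proof. by case: x => a b /=; rewrite mul0r subr0. Qed.

Lemma complex_ImZ (h : R) (x : C) : complex.Im (h%:C%C * x) = h * complex.Im x.
Proof. by case: x => a b /=; rewrite mul0r addr0. Qed.

Lemma cdiff_line (f : C -> C) (w k d : C) (t : R) :
  cdiff f (w + t%:C%C * k) d ->
  is_derive t 1 (fun s => complex.Re (f (w + s%:C%C * k))) (complex.Re (k * d)) /\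
  is_derive t 1 (fun s => complex.Im (f (w + s%:C%C * k))) (complex.Im (k * d)).
Proof.
move=> H.
have key e : 0 < e -> exists2 r : R, 0 < r & forall h : R, `|h| < r ->
    cnorm (f (w + (h + t)%:C%C * k) - f (w + t%:C%C * k) - h%:C%C * (k * d))
      <= e * `|h|.
  move=> e0; have k0 : 0 < 1 + cnorm k by rewrite ltr_pwDl// cnorm_ge0.
  have [r r0 Hr] := H _ (divr_gt0 e0 k0).
  exists (r / (1 + cnorm k)); first exact: divr_gt0.
  move=> h; rewrite ltr_pdivlMr// => hr.
  have nk : cnorm (h%:C%C * k) = `|h| * cnorm k by rewrite cnormM cnorm_real.
  have i1 : cnorm (h%:C%C * k) < r.
    by rewrite nk; apply: le_lt_trans hr; rewrite ler_wpM2l// lerDr.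
  have := Hr _ i1; rewrite nk => i2.
  have -> : w + (h + t)%:C%C * k = w + t%:C%C * k + h%:C%C * k.
    by rewrite rmorphD /= mulrDl [h%:C%C * _ + _]addrC addrA.
  rewrite [h%:C%C * (k * d)]mulrA; apply: (le_trans i2).
  have -> : e / (1 + cnorm k) * (`|h| * cnorm k)
     = e * `|h| * (cnorm k / (1 + cnorm k)) by ring.
  by rewrite ler_piMr ?mulr_ge0 ?(ltW e0)// ler_pdivrMr// mul1r lerDr.
split; apply: is_derive_eps => e e0; have [r r0 Hr] := key e e0;
  exists r => // h hr; apply: le_trans (Hr h hr).
  by rewrite -complex_ReZ -!complex_ReB Re_le_cnorm.
by rewrite -complex_ImZ -!complex_ImB Im_le_cnorm.
Qed.

(** The real mean value inequality is applied to Re and Im separately along the segment, hence the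
    factor 2. *)
Lemma cmean_value (f df : C -> C) (w k c : C) (e : R) :
  (forall t : R, `|t| <= 1 -> cdiff f (w + t%:C%C * k) (df (w + t%:C%C * k))) ->
  (forall t : R, `|t| <= 1 -> cnorm (df (w + t%:C%C * k) - c) <= e) ->
  cnorm (f (w + k) - f w - k * c) <= 2 * e * cnorm k.
Proof.
move=> hd hb.
have nn (t : R) : `|t - 0| <= `|1 - 0 : R| -> `|t| <= 1 by rewrite !subr0 normr1.
have e0 : cnorm k * e = e * cnorm k by rewrite mulrC.
have kb t : `|t| <= 1 -> cnorm (k * df (w + t%:C%C * k) - k * c) <= e * cnorm k.
  by move=> ht; rewrite -mulrBr cnormM -e0 ler_wpM2l ?cnorm_ge0 ?hb.
have i1 := @mean_value_ineq R (fun s => complex.Re (f (w + s%:C%C * k)))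
  (fun s => complex.Re (k * df (w + s%:C%C * k))) 0 1 (complex.Re (k * c))
  (e * cnorm k) (fun s hs => (cdiff_line (hd s (nn s hs))).1).
have i2 := @mean_value_ineq R (fun s => complex.Im (f (w + s%:C%C * k)))
  (fun s => complex.Im (k * df (w + s%:C%C * k))) 0 1 (complex.Im (k * c))
  (e * cnorm k) (fun s hs => (cdiff_line (hd s (nn s hs))).2).
move: i1 i2; rewrite !mul1r !mul0r !addr0 !subr0 !normr1 !mulr1.
rewrite -!complex_ReB -!complex_ImB => i1 i2.
apply: (le_trans (cnorm_le_ReIm _)).
have -> : 2 * e * cnorm k = e * cnorm k + e * cnorm k by ring.
apply: lerD.
  apply: i1 => s; rewrite subr0 => hs; rewrite -complex_ReB.
  exact: le_trans (Re_le_cnorm _) (kb s hs).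
apply: i2 => s; rewrite subr0 => hs; rewrite -complex_ImB.
exact: le_trans (Im_le_cnorm _) (kb s hs).
Qed.

(** The intervals of radius G |k| around X k meet pairwise, so the supremum of their left ends lies
    in all of them. This is the limit of X at 0, together with its rate. *)
Lemma common_point (X : C -> R) (G : R) (D : set C) : D !=set0 ->
  (forall k l, D k -> D l -> `|X k - X l| <= G * (cnorm k + cnorm l)) ->
  exists x, forall k, D k -> `|X k - x| <= G * cnorm k.
Proof.
move=> [k0 Dk0] H; pose S := [set X k - G * cnorm k | k in D].
have ub l : D l -> ubound S (X l + G * cnorm l).
  move=> Dl _ [k Dk <-]; have := H k l Dk Dl; rewrite ler_norml mulrDr; lra.
exists (sup S) => k Dk; rewrite ler_norml.
have h1 : X k - G * cnorm k <= sup S.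
  by apply: ub_le_sup; [exists (X k0 + G * cnorm k0); exact: ub|exists k].
have h2 : sup S <= X k + G * cnorm k.
  by apply: ge_sup; [exists (X k0 - G * cnorm k0), k0|exact: ub].
by lra.
Qed.

(** The Cauchy estimate is used three times: on f it bounds f'; on the difference quotients q_k,
    bounded by the mean value inequality, it makes f' Lipschitz. Then q_k is within 2 La |k| of f',
    and the third use, on q_k - q_l, gives |Q_k - Q_l| <= G (|k| + |l|) for Q_k = q_k'(z), the
    difference quotients of f' at z. Shrinking balls inside 4 r leave room for these uses. *)
Lemma cderiv_cdiff (f df : C -> C) z (r B : R) : 0 < r ->
  (forall k, cnorm k <= 4 * r -> cdiff f (z + k) (df (z + k))) ->
  (forall k, cnorm k <= 4 * r -> cnorm (f (z + k)) <= B) ->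
  exists d, cdiff df z d.
Proof.
move=> r0 hd hB.
have nD j k (a b : R) : cnorm j <= a -> cnorm k <= b -> cnorm (j + k) <= a + b.
  by move=> h1 h2; apply: (le_trans (cnormD _ _)); exact: lerD.
have nT (t : R) k : `|t| <= 1 -> cnorm (t%:C%C * k) <= cnorm k.
  by move=> ht; rewrite cnormM cnorm_real ler_piMl ?cnorm_ge0.
have B0 : 0 <= B.
  have := hB 0; rewrite cnorm0 => /(_ _)/(le_trans (cnorm_ge0 _)); apply; lra.
pose L := 4 * B / r.
have L0 : 0 <= L by rewrite !mulr_ge0// invr_ge0 ltW.
have hL k : cnorm k <= 3 * r -> cnorm (df (z + k)) <= L.
  move=> hk; apply: (@cauchy_estimate R f (z + k)) => //.
  - move=> k' hk'; exists (df (z + k + k')); rewrite -addrA; apply: hd.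
    by have := nD _ _ _ _ hk hk'; lra.
  - by move=> k' hk'; rewrite -addrA; apply: hB; have := nD _ _ _ _ hk hk'; lra.
  - by apply: hd; lra.
have hLip j k : cnorm j <= 2 * r -> cnorm k <= r ->
    cnorm (f (z + j + k) - f (z + j)) <= 2 * L * cnorm k.
  move=> hj hk; have := @cmean_value f df (z + j) k 0 L.
  rewrite mulr0 subr0; apply => t ht.
    rewrite -addrA; apply: hd.
    by have := nD _ _ _ _ hj (le_trans (nT _ _ ht) hk); lra.
  rewrite subr0 -addrA; apply: hL.
  by have := nD _ _ _ _ hj (le_trans (nT _ _ ht) hk); lra.
(* The added 0 gives q k the affine shape of [cdiff_affine]. *)
pose q k w := k^-1 * (f (w + k) - f w) + 0.
have hq k j : cnorm k <= r -> cnorm j <= 3 * r ->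
    cdiff (q k) (z + j) (k^-1 * (df (z + j + k) - df (z + j))).
  move=> hk hj; apply: cdiff_affine; apply: cdiffB; last by apply: hd; lra.
  apply: cdiff_shift; rewrite -addrA; apply: hd.
  by have := nD _ _ _ _ hj hk; lra.
pose La := 4 * (2 * L) / r.
have La0 : 0 <= La by rewrite !mulr_ge0// invr_ge0 ltW.
have hLa j k : cnorm j <= r -> cnorm k <= r ->
    cnorm (df (z + j + k) - df (z + j)) <= La * cnorm k.
  move=> hj hk; have [->|k0] := eqVneq k 0.
    by rewrite addr0 subrr cnorm0 mulr0.
  have k1 : 0 < cnorm k by rewrite cnorm_gt0.
  have : cnorm (k^-1 * (df (z + j + k) - df (z + j))) <= La.
    apply: (@cauchy_estimate R (q k) (z + j)) => //.
    - move=> k' hk'; rewrite -addrA; eexists; apply: hq => //.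
      by have := nD _ _ _ _ hj hk'; lra.
    - move=> k' hk'; rewrite /q addr0 cnormM cnormV ler_pdivrMl// mulrC.
      rewrite -(addrA z); apply: hLip => //.
      by have := nD _ _ _ _ hj hk'; lra.
    - by apply: hq => //; lra.
  by rewrite cnormM cnormV ler_pdivrMl// mulrC.
have hqd j k : cnorm j <= r -> cnorm k <= r -> k != 0 ->
    cnorm (q k (z + j) - df (z + j)) <= 2 * La * cnorm k.
  move=> hj hk k0; have k1 : 0 < cnorm k by rewrite cnorm_gt0.
  have := @cmean_value f df (z + j) k (df (z + j)) (La * cnorm k).
  have -> : q k (z + j) - df (z + j) =
      k^-1 * (f (z + j + k) - f (z + j) - k * df (z + j)).
    by rewrite /q; field.
  rewrite cnormM cnormV => H; rewrite ler_pdivrMl//.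
  have -> : cnorm k * (2 * La * cnorm k) = 2 * (La * cnorm k) * cnorm k by ring.
  apply: H => t ht.
    rewrite -addrA; apply: hd.
    by have := nD _ _ _ _ hj (le_trans (nT _ _ ht) hk); lra.
  apply: (le_trans (hLa _ _ hj (le_trans (nT _ _ ht) hk))).
  by rewrite ler_wpM2l// nT.
pose Q k := k^-1 * (df (z + k) - df z).
pose G := 4 * (2 * La) / r.
have G0 : 0 <= G by rewrite !mulr_ge0// invr_ge0 ltW.
pose D := [set k : C | k != 0 /\ cnorm k <= r].
have hQ k l : D k -> D l -> cnorm (Q k - Q l) <= G * (cnorm k + cnorm l).
  move=> [k0 hk] [l0 hl].
  have -> : G * (cnorm k + cnorm l) = 4 * (2 * La * (cnorm k + cnorm l)) / r.
    by rewrite /G; ring.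
  have hq0 m (hm : cnorm m <= r) : cdiff (q m) z (Q m).
    by have := hq m 0 hm; rewrite addr0 cnorm0; apply; lra.
  apply: (@cauchy_estimate R (fun w => q k w - q l w) z) => //.
  - move=> k' hk'; eexists; apply: cdiffB; apply: hq => //; lra.
  - move=> k' hk'; rewrite mulrDr.
    have -> : q k (z + k') - q l (z + k') = (q k (z + k') - df (z + k'))
       - (q l (z + k') - df (z + k')) by ring.
    by apply: (le_trans (cnormD _ _)); rewrite cnormN lerD// hqd.
  - by apply: cdiffB; exact: hq0.
have D0 : D !=set0.
  exists r%:C%C; split; last by rewrite cnorm_real ger0_norm// ltW.
  by rewrite -cnorm_gt0 cnorm_real gtr0_norm.
have [x hx] := @common_point (fun k => complex.Re (Q k)) G D D0 (fun k l Dk Dl =>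
  ltac:(rewrite -complex_ReB; exact: le_trans (Re_le_cnorm _) (hQ k l Dk Dl))).
have [y hy] := @common_point (fun k => complex.Im (Q k)) G D D0 (fun k l Dk Dl =>
  ltac:(rewrite -complex_ImB; exact: le_trans (Im_le_cnorm _) (hQ k l Dk Dl))).
exists (x +i* y)%C => e e0.
have g0 : 0 < 1 + 2 * G by rewrite ltr_pwDl// mulr_ge0.
exists (Num.min r (e / (1 + 2 * G))); first by rewrite lt_min r0 divr_gt0.
move=> k; rewrite lt_min => /andP[k1 k2].
have [->|k0] := eqVneq k 0.
  by rewrite addr0 subrr mul0r subrr cnorm0 mulr0.
have Dk : D k by split => //; exact: ltW.
have -> : df (z + k) - df z - k * (x +i* y)%C = k * (Q k - (x +i* y)%C).
  by rewrite mulrBr mulrA divff// mul1r.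
rewrite cnormM mulrC ler_wpM2r ?cnorm_ge0//.
apply: (le_trans (cnorm_le_ReIm _)); rewrite complex_ReB complex_ImB /=.
apply: (le_trans (lerD (hx k Dk) (hy k Dk))).
move: k2; rewrite ltr_pdivlMr// => /ltW; apply: le_trans.
by rewrite mulrC; have := cnorm_ge0 k; nra.
Qed.

End HolomorphicDerivative.

(** * Holomorphic functions on the real line and their weight class *)

Section HolomorphicRealLine.
Variable R : realType.
Local Notation C := R[i].

(** A total function, with value 0 where no derivative exists, so that it can be iterated. *)
Definition cD (f : C -> C) (z : C) : C := xget 0 [set d | cdiff f z d].

Lemma cDP (f : C -> C) z : (exists d, cdiff f z d) -> cdiff f z (cD f z).
Proof. by move=> H; exact: (xgetPex 0 H). Qed.

Definition copen (O : set C) : Prop :=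
  forall z, O z -> exists2 r : R, 0 < r & forall k, cnorm k <= r -> O (z + k).

Lemma open_copen (O : set C) : open (O : set C^o) -> copen O.
Proof.
rewrite openE => oO z Oz; have /nbhs_ballP[r /= r0 Hr] := oO z Oz.
have [rE rR0] := pos_complex r0.
exists (complex.Re r / 2) => [|k hk]; first by lra.
apply: Hr; rewrite -?ball_normE /ball_ /= opprD addNKr normrN -cnormC rE ltcR.
by lra.
Qed.

Definition chol (O : set C) (f : C -> C) : Prop :=
  forall z, O z -> exists d, cdiff f z d.

Lemma cdiff_bounded (f : C -> C) z d : cdiff f z d ->
  exists2 r : R, 0 < r & forall k, cnorm k <= r ->
    cnorm (f (z + k)) <= cnorm (f z) + (1 + cnorm d).
Proof.
move=> /(_ 1 ltr01)[r r0 Hr]; exists (Num.min (r / 2) 1).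
  by rewrite lt_min ltr01 divr_gt0.
move=> k; rewrite le_min => /andP[k1 k2].
have kr : cnorm k < r by lra.
have -> : f (z + k) = f z + ((f (z + k) - f z - k * d) + k * d) by ring.
apply: (le_trans (cnormD _ _)); rewrite lerD2l.
apply: (le_trans (cnormD _ _)); apply: lerD.
  by apply: (le_trans (Hr k kr)); rewrite mul1r.
by rewrite cnormM ler_piMl ?cnorm_ge0.
Qed.

Lemma chol_local (O : set C) (f : C -> C) z : copen O -> chol O f -> O z ->
  exists r B : R, [/\ 0 < r, 0 <= B &
    forall k, cnorm k <= r -> O (z + k) /\ cnorm (f (z + k)) <= B].
Proof.
move=> oO hf Oz; have [d hd] := hf z Oz.
have [r1 r10 H1] := oO z Oz; have [r2 r20 H2] := cdiff_bounded hd.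
exists (Num.min r1 r2), (cnorm (f z) + (1 + cnorm d)); split.
- by rewrite lt_min r10.
- by rewrite !addr_ge0 ?cnorm_ge0.
by move=> k; rewrite le_min => /andP[k1 k2]; split; [exact: H1|exact: H2].
Qed.

Lemma chol_cD (O : set C) (f : C -> C) : copen O -> chol O f -> chol O (cD f).
Proof.
move=> oO hf z Oz; have [r [B [r0 B0 H]]] := chol_local oO hf Oz.
have r4 : 4 * (r / 4) = r by field.
have r40 : 0 < r / 4 by lra.
apply: (@cderiv_cdiff R f (cD f) z (r / 4) B) => //; rewrite r4 => k hk.
  by apply: cDP; apply: hf; have [] := H k hk.
by have [] := H k hk.
Qed.

Lemma chol_iter (O : set C) (f : C -> C) n : copen O -> chol O f ->
  chol O (iter n cD f).
Proof. by move=> oO hf; elim: n => [//|n IH] /=; exact: chol_cD. Qed.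

(** Each of the n derivatives spends a = r / n of the radius and costs a factor 4 / a. The total (4
    n / r)^n is at most n! (16 / r)^n because n^n <= 4^n n!. *)
Lemma iter_cD_bound (O : set C) (f : C -> C) z (r B : R) n :
  copen O -> chol O f -> 0 < r -> 0 <= B ->
  (forall k, cnorm k <= r -> O (z + k) /\ cnorm (f (z + k)) <= B) ->
  cnorm (iter n cD f z) <= B * (n`!%:R * (16 / r) ^+ n).
Proof.
move=> oO hf r0 B0 H.
have [->|n0] := posnP n.
  have := H 0; rewrite cnorm0 addr0 fact0 expr0 !mulr1 => /(_ (ltW r0)).
  by case.
have nR : 0 < n%:R :> R by rewrite ltr0n.
pose a := r / n%:R; have a0 : 0 < a by rewrite divr_gt0.
have an : a * n%:R = r by rewrite divfK// gt_eqF.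
have main j : (j <= n)%N -> forall k, cnorm k <= a * (n - j)%:R ->
    cnorm (iter j cD f (z + k)) <= B * (4 / a) ^+ j.
  elim: j => [_|j IH jn] k hk.
    by rewrite expr0 mulr1; apply: (H k _).2; rewrite subn0 an in hk.
  have E : a * (n - j)%:R = a * (n - j.+1)%:R + a.
    by rewrite -[(n - j)%N]prednK ?subn_gt0// -subnS -natr1 mulrDr mulr1.
  have hk' k' : cnorm k' <= a -> cnorm (k + k') <= a * (n - j)%:R.
    by move=> h'; rewrite E; apply: (le_trans (cnormD _ _)); exact: lerD.
  have Ok k' : cnorm k' <= a -> O (z + k + k').
    move=> h'; rewrite -addrA; apply: (H _ _).1; apply: (le_trans (hk' _ h')).
    by rewrite -an ler_wpM2l ?(ltW a0)// ler_nat leq_subr.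
  have -> : B * (4 / a) ^+ j.+1 = 4 * (B * (4 / a) ^+ j) / a.
    by rewrite exprS; ring.
  apply: (@cauchy_estimate R (iter j cD f) (z + k)) => //.
  - by move=> k' h'; apply: (chol_iter j oO hf); exact: Ok.
  - by move=> k' h'; rewrite -addrA; apply: IH; [exact: ltnW|exact: hk'].
  - apply: cDP; apply: (chol_iter j oO hf).
    by rewrite -[z + k]addr0; apply: Ok; rewrite cnorm0 ltW.
have := main n (leqnn n) 0; rewrite subnn mulr0 cnorm0 addr0 => /(_ (lexx _)) h.
apply: (le_trans h); rewrite ler_wpM2l//.
have -> : 4 / a = n%:R * (4 / r) by rewrite /a invf_div; ring.
have -> : 16 / r = 4 * (4 / r) by ring.
have q0 : 0 <= 4 / r by rewrite divr_ge0 ?(ltW r0).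
move: (4 / r) q0 => q q0; rewrite !exprMn [leRHS]mulrA.
rewrite ler_wpM2r ?exprn_ge0//.
by rewrite -!natrX -natrM ler_nat mulnC expnn_le_fact.
Qed.

(** A single rho serves as both constant and rate, so any large rho works near a given point and
    compactness gives one for all of K. Half the local radius is kept so that discs around nearby
    points stay inside. *)
Lemma compact_derivative_bound (O : set C) (f : C -> C) (K : set 'rV[R]_1) :
  copen O -> chol O f -> compact K ->
  (forall x, K x -> O (x ord0 ord0)%:C%C) ->
  exists2 rho : R, 0 < rho & forall x n, K x ->
    cnorm (iter n cD f (x ord0 ord0)%:C%C) <= rho * (n`!%:R * rho ^+ n).
Proof.
move=> oO hf cK KO.
pose P (rho : R) (x : 'rV[R]_1) := forall n,
  cnorm (iter n cD f (x ord0 ord0)%:C%C) <= rho * (n`!%:R * rho ^+ n).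
have [] : (\forall rho \near +oo, K `<=` P rho)%R.
  move/compact_near_coveringP: cK; apply => x Kx.
  have [r [B [r0 B0 H]]] := chol_local oO hf (KO x Kx).
  have r20 : 0 < r / 2 by lra.
  exists (ball x (r / 2), [set rho | B + 16 / (r / 2) < rho]).
    split; first exact: nbhsx_ballx.
    exact: nbhs_pinfty_gt (num_real _).
  move=> [x' rho] /= [hx hrho] n.
  have B16 : 0 <= 16 / (r / 2) by rewrite divr_ge0 ?(ltW r20).
  have hx' : `|x' ord0 ord0 - x ord0 ord0| <= r / 2.
    have : `|x' - x| <= r / 2 by move: hx; rewrite -ball_normE /= distrC => /ltW.
    by apply: le_trans; have := row_coord_norm_le (x' - x) ord0; rewrite !mxE.
  have := @iter_cD_bound O f (x' ord0 ord0)%:C%C (r / 2) B n oO hf r20 B0.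
  move=> /(_ _)/le_trans; apply.
    move=> k hk.
    have -> : (x' ord0 ord0)%:C%C + k = (x ord0 ord0)%:C%C
        + ((x' ord0 ord0 - x ord0 ord0)%:C%C + k).
      by rewrite rmorphB /=; ring.
    by apply: H; apply: (le_trans (cnormD _ _)); rewrite cnorm_real; lra.
  have i1 : B <= rho by lra.
  have i2 : 16 / (r / 2) <= rho by lra.
  apply: ler_pM => //; first by rewrite mulr_ge0// exprn_ge0.
  rewrite ler_wpM2l// lerXn2r ?nnegrE//; exact: le_trans i2.
move=> A [Ar HA]; exists (1 + `|A|); first by rewrite ltr_pwDl.
move=> x n Kx; apply: HA => //.
by rewrite (le_lt_trans (ler_norm _))// ltrDr.
Qed.

(** A positive lower limit gives a positive lower bound c for the roots on some tail; the factor d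
    absorbs the finitely many earlier indices. *)
Lemma Comega_lower (M : nat -> R) : (forall k, 0 < M k) ->
  (0 < limn_einf (fun k : nat => ((M k) `^ (k%:R^-1))%:E))%E ->
  exists c d : R, [/\ 0 < c, 0 < d & forall k, d * c ^+ k <= M k].
Proof.
move=> M0; rewrite limn_einf_lim; set u := (fun k => _).
rewrite (cvg_lim _ (@cvg_einfs_sup _ u))// => h.
have [n hn] : exists n, (0 < einfs u n)%E.
  apply: contrapT => /forallNP H; move: h; apply/negP; rewrite -leNgt.
  apply: ge_ereal_sup => _ [n _ <-]; rewrite leNgt; exact/negP.
have lb k : (n <= k)%N -> (einfs u n <= u k)%E.
  by move=> nk; apply: ereal_inf_lbound; exists k.
have [c c0 hc] : exists2 c : R, 0 < c & forall k, (n <= k)%N -> c <= M k `^ k%:R^-1.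
  case E : (einfs u n) hn lb => [c| |] hn lbn //.
    by exists c => // k nk; rewrite -lee_fin; exact: lbn.
  by have := lbn n (leqnn n); rewrite leye_eq.
exists c.
(* Starting at n + 1 excludes k = 0, where the root is 1 whatever M 0 is. *)
have hbig k : (n.+1 <= k)%N -> c ^+ k <= M k.
  move=> nk; rewrite -[leRHS](@powR_invn_exprn _ _ k) ?(ltW (M0 k))//; last first.
    by case: k nk.
  by rewrite lerXn2r ?nnegrE ?(ltW c0) ?powR_ge0// hc// ltnW.
have [d d0 hd] : exists2 d : R, 0 < d <= 1 & forall k, (k < n.+1)%N -> d * c ^+ k <= M k.
  elim: (n.+1) => [|m [d /andP[d0 d1] hd]]; first by exists 1; rewrite ?ltr01 ?lexx.
  exists (Num.min d (M m / c ^+ m)).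
    by rewrite lt_min d0 divr_gt0 ?exprn_gt0//= ge_min d1.
  move=> k; rewrite ltnS leq_eqVlt => /predU1P[->|km].
    by rewrite -ler_pdivlMr ?exprn_gt0// ge_min lexx orbT.
  apply: le_trans (hd k km); rewrite ler_wpM2r ?exprn_ge0 ?(ltW c0)//.
  by rewrite ge_min lexx.
have /andP[d1 d2] := d0.
exists d; split => // k; have [kn|nk] := ltnP k n.+1; first exact: hd.
apply: le_trans (hbig k nk); rewrite ler_piMl ?exprn_ge0 ?(ltW c0)//.
Qed.

Lemma holomorphic_in_EWM (Lam : set R) (M : R -> nat -> R) (O : set C)
    (f : C -> C) : weight_matrix Lam M -> WM_Comega Lam M ->
  open (O : set C^o) -> holomorphic_on O f ->
  open [set x : 'rV[R]_1 | O (x ord0 ord0)%:C%C] /\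
  in_EWM Lam M [set x : 'rV[R]_1 | O (x ord0 ord0)%:C%C]
    (fun x => C_as_R2 (f (x ord0 ord0)%:C%C)).
Proof.
move=> [Mpos _ _ _ _] [l [Ll hl]] /open_copen oO holf.
have hf : chol O f by move=> z Oz; apply: derivable_cdiff; exact: holf.
pose T := [set t : R | O t%:C%C].
have oT : open T.
  rewrite openE => t Tt; have [r r0 Hr] := oO _ Tt.
  apply/nbhs_ballP; exists r => // t'; rewrite -?ball_normE /ball_ /= distrC => ht.
  rewrite /T /= -[t'](subrK t) addrC rmorphD; apply: Hr.
  by rewrite cnorm_real ltW.
pose S (c : 'I_2) k (t : R) := if c == ord0 then complex.Re (iter k cD f t%:C%C)
  else complex.Im (iter k cD f t%:C%C).
have dS c k t : T t -> is_derive t 1 (S c k) (S c k.+1 t).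
  move=> Tt; have := cDP (chol_iter k oO hf Tt) => h.
  have := @cdiff_line R (iter k cD f) 0 1 (cD (iter k cD f) t%:C%C) t.
  rewrite add0r mulr1 mul1r => /(_ h)[h1 h2].
  rewrite /S; case: (c == ord0).
    rewrite (_ : (fun s => _) = (fun s => complex.Re (iter k cD f (0 + s%:C%C * 1))))//.
    by apply/funext => s; rewrite add0r mulr1.
  rewrite (_ : (fun s => _) = (fun s => complex.Im (iter k cD f (0 + s%:C%C * 1))))//.
  by apply/funext => s; rewrite add0r mulr1.
have dsS c := Ds_one_var oT (dS c).
have oV := (dsS ord0).1; split; first exact: oV.
have E c : (fun y : 'rV[R]_1 => C_as_R2 (f (y ord0 ord0)%:C%C) ord0 c)
    = (fun y => S c 0%N (y ord0 ord0)).
  by apply/funext => y; rewrite mxE.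
apply/(in_EWM_coordP _ Mpos oV); split.
  by move=> c vs x Vx; rewrite E; have [_ /(_ vs x Vx)[]] := dsS c.
move=> K KV cK; exists l; split => //.
have [rho rho0 Hrho] := compact_derivative_bound oO hf cK KV.
have [c [d [c0 d0 Hcd]]] := Comega_lower (Mpos l Ll) hl.
(* Dividing by c and d turns the analytic bound rho n! rho^n into a class bound, as d c^n <= M_n. *)
exists (rho / c), (rho / d); split; [exact: divr_gt0|by rewrite ltW ?divr_gt0|].
move=> x vs i Kx evs; rewrite E; have [_ /(_ vs x (KV _ Kx))[_ ->]] := dsS i.
set n := size vs.
have hS : `|S i n (x ord0 ord0)| <= rho * (n`!%:R * rho ^+ n).
  apply: le_trans (Hrho x n Kx); rewrite /S.
  by case: (i == ord0); [exact: Re_le_cnorm|exact: Im_le_cnorm].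
rewrite normrM; apply: (@le_trans _ _ (rho * (n`!%:R * rho ^+ n))).
  by rewrite -[leRHS]mul1r ler_pM// prod_coord_le1.
have -> : rho / d * (n`!%:R * (rho / c) ^+ n * M l n)
   = rho * (n`!%:R * rho ^+ n) * ((d * c ^+ n)^-1 * M l n).
  by rewrite expr_div_n invfM; ring.
rewrite ler_peMr//; first by rewrite !mulr_ge0 ?exprn_ge0 ?(ltW rho0).
by rewrite ler_pdivlMl ?mulr_gt0 ?exprn_gt0// mulr1.
Qed.

Lemma stable_holomorphically_closed (Lam : set R) (M : R -> nat -> R) :
  weight_matrix Lam M -> WM_Comega Lam M ->
  stable_under_composition Lam M -> holomorphically_closed Lam M.
Proof.
move=> wM cM st n U oU g f gE [Om [oO gO holf]].
have [oV fE] := holomorphic_in_EWM wM cM oO holf.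
pose F (x : 'rV[R]_1) := C_as_R2 (f (x ord0 ord0)%:C%C).
have [] := st n 1%N 2%N U _ setT oU oV openT g F.
- by split => // x Ux; exact: gO.
- by split.
by [].
Qed.

End HolomorphicRealLine.

Theorem theorem4p9 (R : realType) (Lam : set R) (M : R -> nat -> R) :
  weight_matrix Lam M ->
  (* main equivalence under (M_{dc}) and (M_{C^omega}) *)
  ((WM_dc Lam M -> WM_Comega Lam M ->
     [/\ stable_under_composition Lam M <-> holomorphically_closed Lam M,
         holomorphically_closed Lam M <-> WM_root_cond Lam M &
         WM_root_cond Lam M <-> WM_FdB Lam M])
  (* refinement: which hypothesis each implication uses *)
  /\ (WM_Comega Lam M -> stable_under_composition Lam M -> holomorphically_closed Lam M)
  /\ (holomorphically_closed Lam M -> WM_root_cond Lam M)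
  /\ (WM_dc Lam M -> WM_root_cond Lam M -> WM_FdB Lam M)
  /\ (WM_FdB Lam M -> stable_under_composition Lam M)).
Proof.
move=> wM.
have i12 := @stable_holomorphically_closed R Lam M wM.
have i23 := @holomorphically_closed_root R Lam M wM.
have i34 := @root_cond_FdB R Lam M wM.
have i41 := @FdB_stable R Lam M wM.
split; last by split; [exact: i12|split; [exact: i23|split; [exact: i34|exact: i41]]].
move=> dc cw; split; split.
- exact: i12.
- by move=> /i23 /(i34 dc) /i41.
- exact: i23.
- by move=> /(i34 dc) /i41; exact: i12.
- exact: i34.
- by move=> /i41 /(i12 cw) /i23.
Qed.
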